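(* Let $S>0$ and let the parameters $a\in\mathbb{R}$ and $c>0$ be such that the triangle $\Omega_{a,c}$ is not equilateral. Let $\theta_\star\in(0,\pi/3)$ be the smallest angle of $\Omega_{a,c}$. Let $L'>0$ be the length of the smaller side of $\Omega_{a,c}$ adjacent to that angle. Assume that $\alpha<0$ is such that $$-4\alpha^2+\frac{24\alpha}{\sqrt{\sqrt3\,S}}-\frac{36}{\sqrt3\,S}\;\ge\;-\frac{\alpha^2}{\sin^2(\theta_\star/2)}\Big(1-2\exp\big(2\alpha L'\cot(\theta_\star/2)\big)\Big).\qquad( * )$$ Then the inequality $$\lambda_{a,c}<\lambda_0$$ holds. In particular, for a fixed triangle $\Omega_{a,c}$ the condition $( * )$ holds for all $|\alpha|$ large enough, and for a fixed $\alpha<0$ (and fixed area $S$) the condition $( * )$ holds for all $\theta_\star$ small enough.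
   Context: For a bounded Lipschitz domain $\Omega\subset\mathbb{R}^2$ and $\alpha\in\mathbb{R}$, the lowest Robin eigenvalue is $$\lambda_1^\alpha(\Omega)=\inf_{u\in H^1(\Omega),\,u\neq0}\frac{\int_\Omega|\nabla u|^2+\alpha\int_{\partial\Omega}|u|^2}{\int_\Omega|u|^2},$$ with the boundary integral understood in the sense of traces. For fixed $S>0$, $a\in\mathbb{R}$ and $c>0$, $\Omega_{a,c}$ denotes the (open) triangle with vertices $(-c,0)$, $(c,0)$ and $(a,S/c)$, which has area $S$. With $c_0:=\sqrt{S/\sqrt3}$, $\Omega_0:=\Omega_{0,c_0}$ is the equilateral triangle of area $S$. Write $\lambda_{a,c}:=\lambda_1^\alpha(\Omega_{a,c})$ and $\lambda_0:=\lambda_1^\alpha(\Omega_0)$ (both depend on $\alpha$). The last sentence of the claim concerns negative $\alpha$ and means: for each non-equilateral $\Omega_{a,c}$ there is $\alpha_\star<0$ such that $( * )$ holds for all $\alpha\le\alpha_\star$; and for each $\alpha<0$ there is $\theta_0>0$ such that $( * )$ holds for every triangle $\Omega_{a,c}$ (of area $S$) with $\theta_\star<\theta_0$. *)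

(* Defs.v *)
From mathcomp Require Import all_boot all_order all_algebra.
From mathcomp Require Import all_classical all_reals all_analysis.

Set Implicit Arguments.
Unset Strict Implicit.
Unset Printing Implicit Defensive.

Import Order.TTheory GRing.Theory Num.Theory.
Import numFieldNormedType.Exports.

Local Open Scope classical_set_scope.
Local Open Scope ring_scope.

Section Plane.
Context {R : realType}.

Definition leb2 :
    {measure set (measurableTypeR R * measurableTypeR R) -> \bar R} :=
  (@lebesgue_measure R \x @lebesgue_measure R)%E.

(* The library norm on R * R is the maximum norm, so the Euclidean structure
   is spelled out. *)
Definition dot (p q : R * R) : R := p.1 * q.1 + p.2 * q.2.
Definition norm2 (p : R * R) : R := Num.sqrt (dot p p).

Definition square_integrable d (T : measurableType d)
    (mu : {measure set T -> \bar R}) (D : set T) (f : T -> R) : Prop :=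
  measurable_fun D f /\ (\int[mu]_(x in D) (f x ^+ 2)%:E < +oo)%E.

Definition iter_derive (vs : seq (R * R)) (f : R * R -> R) : R * R -> R :=
  foldr (fun v h p => 'D_v h p) f vs.

(* C^oo on the whole plane. *)
Definition smooth (f : R * R -> R) : Prop :=
  forall vs : seq (R * R), continuous (iter_derive vs f) /\
    forall p v, derivable (iter_derive vs f) p v.

Definition test_function (Omega : set (R * R)) (phi : R * R -> R) : Prop :=
  let supp := closure [set p | phi p != 0] in
  [/\ smooth phi, compact supp & supp `<=` Omega].

(* u belongs to H^1(Omega) and G is its distributional gradient. *)
Definition H1_with_gradient (Omega : set (R * R))
    (u : R * R -> R) (G : R * R -> R * R) : Prop :=
  [/\ square_integrable leb2 Omega u,
      square_integrable leb2 Omega (fun p => (G p).1),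
      square_integrable leb2 Omega (fun p => (G p).2) &
      forall phi v, test_function Omega phi ->
        \int[leb2]_(p in Omega) (u p * 'D_v phi p) =
        - \int[leb2]_(p in Omega) (dot (G p) v * phi p)].

End Plane.

(* A triangle is given by its three vertices; [ordS] and [ord_pred] are the
   cyclic successor and predecessor on 'I_3. *)
Section Triangle.
Context {R : realType}.
Implicit Type T : 'I_3 -> R * R.

Definition open_triangle T : set (R * R) :=
  [set p | exists t : 'I_3 -> R,
    [/\ forall i, 0 < t i, \sum_i t i = 1 & p = \sum_i t i *: T i]].

Definition side_length T (i : 'I_3) : R := norm2 (T (ordS i) - T i).

Definition equilateral T : Prop :=
  forall i j, side_length T i = side_length T j.

Definition angle T (i : 'I_3) : R :=
  let v := T (ordS i) - T i in
  let w := T (ord_pred i) - T i in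
  acos (dot v w / (norm2 v * norm2 w)).

(* If the minimal angle occurs at several vertices, the two quantities below
   do not depend on the choice of the vertex. *)
Definition sharpest_vertex T : 'I_3 := [arg min_(i < ord0) angle T i]%O.

Definition smallest_angle T : R := angle T (sharpest_vertex T).

Definition shorter_adjacent_side T : R :=
  let i := sharpest_vertex T in
  Num.min (side_length T i) (side_length T (ord_pred i)).

Definition side_point T (i : 'I_3) (t : R) : R * R :=
  T i + t *: (T (ordS i) - T i).

(* The integral with respect to arc length over the three sides. *)
Definition boundary_integral T (f : R * R -> R) : \bar R :=
  (\sum_(i < 3) (side_length T i)%:E *
     \int[@lebesgue_measure R]_(t in `[0%R, 1%R]) (f (side_point T i t))%:E)%E.

(* Only the values of g on the boundary matter. *)
Definition boundary_square_integrable T (g : R * R -> R) : Prop :=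
  (forall i, measurable_fun (`[0, 1] : set (measurableTypeR R))
    (fun t => g (side_point T i t))) /\
  (boundary_integral T (fun p => (g p ^+ 2)%R) < +oo)%E.

(* The trace operator is the continuous extension to H^1 of the restriction
   to the boundary of functions that are smooth up to the boundary: g is the
   trace of the H^1 function u with gradient G. *)
Definition is_trace T (u : R * R -> R) (G : R * R -> R * R)
    (g : R * R -> R) : Prop :=
  let Omega := open_triangle T in
  boundary_square_integrable T g /\
  exists phi : nat -> R * R -> R,
    [/\ forall n, smooth (phi n),
        (\int[leb2]_(p in Omega) ((phi n p - u p) ^+ 2)%:E)%E
          @[n --> \oo] --> 0%E,
        (\int[leb2]_(p in Omega)
           (('D_((1, 0) : R * R) (phi n) p - (G p).1) ^+ 2 +
            ('D_((0, 1) : R * R) (phi n) p - (G p).2) ^+ 2)%:E)%E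
          @[n --> \oo] --> 0%E &
        boundary_integral T (fun p => (phi n p - g p) ^+ 2)
          @[n --> \oo] --> 0%E].

Definition robin_quotient (alpha : R) T (u : R * R -> R)
    (G : R * R -> R * R) (g : R * R -> R) : R :=
  let Omega := open_triangle T in
  (\int[leb2]_(p in Omega) dot (G p) (G p) +
     alpha * fine (boundary_integral T (fun p => g p ^+ 2))) /
  \int[leb2]_(p in Omega) (u p ^+ 2).

Definition robin_eigenvalue (alpha : R) T : \bar R :=
  let Omega := open_triangle T in
  ereal_inf [set q | exists u G g,
    [/\ H1_with_gradient Omega u G,
        is_trace T u G g,
        ~ {ae leb2, forall p, Omega p -> u p = 0} &
        q = (robin_quotient alpha T u G g)%:E]].

End Triangle.

Section Family.
Context {R : realType}.

Definition triangle (S a c : R) : 'I_3 -> R * R :=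
  fun i => nth (0, 0) [:: (- c, 0); (c, 0); (a, S / c)] i.

Definition equilateral_triangle (S : R) : 'I_3 -> R * R :=
  triangle S 0 (Num.sqrt (S / Num.sqrt 3)).

Definition cot (x : R) : R := cos x / sin x.

Definition star_condition (S a c alpha : R) : Prop :=
  let theta := smallest_angle (triangle S a c) in
  let L' := shorter_adjacent_side (triangle S a c) in
  - 4 * alpha ^+ 2 + 24 * alpha / Num.sqrt (Num.sqrt 3 * S)
    - 36 / (Num.sqrt 3 * S)
  >= - (alpha ^+ 2 / sin (theta / 2) ^+ 2)
     * (1 - 2 * expR (2 * alpha * L' * cot (theta / 2))).

End Family.

(* Main.v *)
Require Import Defs.
From mathcomp Require Import all_boot all_order all_algebra.
From mathcomp Require Import all_classical all_reals all_analysis.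
From mathcomp Require Import measurable_realfun ring lra.
Set Implicit Arguments.
Unset Strict Implicit.
Unset Printing Implicit Defensive.
Import Order.TTheory GRing.Theory Num.Theory.
Import numFieldNormedType.Exports.
Local Open Scope classical_set_scope.
Local Open Scope ring_scope.

(** Put beta = - alpha > 0, and let r be the inradius of the equilateral triangle
of area S. The height of that triangle is 3 r = sqrt (sqrt 3 * S), so the left
side of [star_condition] is - 4 (beta + 1 / r)^2. The two eigenvalues are
estimated separately, by arguments which both rest on the divergence theorem.

Upper bound for an arbitrary triangle ([robin_eigenvalue_le]). Let theta be the
angle at one of the vertices, e the inner unit vector of its bisector, and take
u p = exp (- k e.p) with k = beta / sin (theta / 2): this is the ground state of
the infinite sector with that vertex. On the two sides issued from the vertex u
satisfies the Robin condition exactly, and on the third side its normal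
derivative is negative. Applying the divergence theorem to u^2 e shows that the
Rayleigh quotient of u is at most - k^2, which is already below the right side
- k^2 (1 - 2 exp (...)) of [star_condition].

Lower bound for the equilateral triangle ([robin_eigenvalue_equilateral_ge]).
Let o be the incentre. The field F p = (beta / r) (p - o) has normal component
beta on each side, divergence 2 beta / r, and norm at most 2 beta, because the
circumradius is 2 r. For smooth f the divergence theorem applied to f^2 F, after
completing a square, gives
  beta int_boundary f^2 <= int |grad f|^2 + (2 beta / r + 4 beta^2) int f^2.
The definition of the trace provides smooth functions which approximate u, its
gradient and its trace at the same time, so the inequality extends to H^1 and
the eigenvalue is at least - (2 beta / r + 4 beta^2) > - 4 (beta + 1 / r)^2.
The strict inequality of the theorem comes from this last step.

The divergence theorem ([divergence_triangle]) is obtained from an affine chart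
onto the triangle with vertices (0,0), (1,0), (0,1), where it is Fubini's theorem
together with the fundamental theorem of calculus.

The two assertions on the validity of [star_condition] are elementary. In a
non-equilateral triangle the smallest angle is below pi / 3
([half_lt_cos_smallest_angle]), so 1 / sin^2 (theta / 2) > 4 and the right side
wins as beta grows. If theta is small and the area is S, the shorter side
adjacent to theta is at least sqrt S ([shorter_adjacent_side_ge]), so the
exponential is small and 1 / sin^2 (theta / 2) wins. *)

(** * Measurability in the plane *)
Section PlaneMeasure.
Context {R : realType}.
Local Notation mu := (@lebesgue_measure R).
Local Notation plane := (measurableTypeR R * measurableTypeR R)%type.

(** The plane carries the product of two Borel structures, so an open set has to
be written as a countable union of products: the squares with rational centre
and radius 1 / (n + 1) contained in it. *)
Lemma open_plane_measurable (U : set (R * R)) :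
  open U -> measurable (U : set plane).
Proof.
move=> oU.
pose sq (q : rat * rat * nat) : set plane :=
  ball (ratr q.1.1 : R) (q.2.+1%:R^-1) `*` ball (ratr q.1.2 : R) (q.2.+1%:R^-1).
(* squares that stick out are replaced by the empty set, to keep a countable index type *)
pose F q : set plane := if `[< sq q `<=` U >] then sq q else set0.
have -> : U = \bigcup_q F q.
  apply/seteqP; split=> [[x y] Uxy|p [q _]]; last first.
    by rewrite /F; case: asboolP => // h; exact: h.
  have /nbhs_ballP[e/= e0 eU] : nbhs (x, y) U by exact: open_nbhs_nbhs.
  have [n ne] : exists n, n.+1%:R^-1 < e / 2.
    have [k _ hk] := near_infty_natSinv_lt (PosNum (divr_gt0 e0 (ltr0Sn R 1))).
    by exists k; exact: hk (leqnn k).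
  have n0 : 0 < n.+1%:R^-1 :> R by rewrite invr_gt0.
  have approx (z : R) : exists a : rat, `|ratr a - z| < n.+1%:R^-1.
    have /rat_in_itvoo[a] : z - n.+1%:R^-1 < z + n.+1%:R^-1.
      by rewrite ltrBlDr -addrA ltrDl addr_gt0.
    by rewrite in_itv/= => h; exists a; rewrite ltr_distl.
  have [a ha] := approx x; have [b hb] := approx y.
  exists (a, b, n) => //; rewrite /F; case: asboolP => [_|[]].
    by split; rewrite /= /ball/=.
  move=> [x' y'] [/=]; rewrite /ball/= => hx hy.
  apply: eU; split; rewrite /ball/=.
    rewrite (_ : x - x' = (x - ratr a) + (ratr a - x')); last ring.
    by rewrite (le_lt_trans (ler_normD _ _))// [ltRHS]splitr ltrD// ?(lt_trans _ ne)// distrC.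
  rewrite (_ : y - y' = (y - ratr b) + (ratr b - y')); last ring.
  by rewrite (le_lt_trans (ler_normD _ _))// [ltRHS]splitr ltrD// ?(lt_trans _ ne)// distrC.
apply: countable_bigcupT_measurable => // q; rewrite /F; case: asboolP => // _.
by apply: measurableX; apply: open_measurable; apply: ball_open; rewrite invr_gt0.
Qed.

Lemma continuous_plane_measurable (f : R * R -> R) (D : set plane) :
  measurable D -> continuous f -> measurable_fun D (f : plane -> R).
Proof.
move=> mD cf; apply: (measurable_funS measurableT) => //.
apply: (measurability _ (RGenOpens.measurableE R)) => _ [_ [a [b ->] <-]].
rewrite setTI; apply: open_plane_measurable.
by apply: open_comp => // x _; exact: cf.
Qed.

(** Both sides are measures in A, hence half-open intervals are enough. *)
Lemma lebesgue_measure_affine (k l : R) (A : set R) : 0 < k -> measurable A ->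
  (k%:E * mu ((fun x => k * x + l)%R @^-1` A) = mu A)%E.
Proof.
move=> k0 mA.
have mphi : measurable_fun setT (fun x : measurableTypeR R => k * x + l : measurableTypeR R).
  by apply: measurable_funD => //; exact: measurable_funM.
pose phi (x : measurableTypeR R) : measurableTypeR R := k * x + l.
pose nu : {measure set measurableTypeR R -> \bar R} :=
  mscale (NngNum (ltW k0)) (pushforward mu phi).
apply/esym; rewrite (@lebesgue_measure_unique R (nu mphi))// => _ [[a b] _ <-] /=.
rewrite /mscale/= /pushforward/=.
have -> : phi @^-1` `]a, b]%classic = `](a - l) / k, (b - l) / k]%classic.
  apply/seteqP; split=> x /=; rewrite !in_itv/= ltr_pdivrMr// ler_pdivlMr//;
    by rewrite /phi ltrBlDr lerBrDr [x * k]mulrC.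
rewrite !lebesgue_measure_itv/= !lte_fin ltr_pM2r ?invr_gt0// ltrBlDr subrK.
case: ifPn => _; last by rewrite mule0.
by rewrite -!EFinD -EFinM; congr EFin; field; rewrite gt_eqF.
Qed.

End PlaneMeasure.

(** * Continuously differentiable functions of two variables *)
Section C1.
Context {R : realType}.
Implicit Types (f g : R * R -> R) (p q v w : R * R).

(** [smooth] speaks of directional derivatives only, and so does this predicate;
the linearity of the derivative in the direction is then a theorem. *)
Definition c1 f := [/\ continuous f, forall p v, derivable f p v &
  forall v, continuous ('D_v f)].

Lemma is_derive_line f p v (x : R) : derivable f (p + x *: v) v ->
  is_derive x 1 (fun t : R => f (p + t *: v)) ('D_v f (p + x *: v)).
Proof.
have E : (fun h : R => h^-1 *: (((fun t => f (p + t *: v)) \o shift x) (h *: 1) -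
      f (p + x *: v))) =
    (fun h => h^-1 *: ((f \o shift (p + x *: v)) (h *: v) - f (p + x *: v))).
  apply/funext => h /=; congr (_ *: (f _ - _)).
  by rewrite scalerDl addrCA /GRing.scale/= mulr1.
move=> dfv; apply: DeriveDef.
  by rewrite /derivable E.
by rewrite /derive E.
Qed.

Lemma deriveZ_direction f p (k : R) v : c1 f ->
  'D_(k *: v) f p = k * 'D_v f p.
Proof.
move=> [_ df _].
have d1 := @is_derive_line f p (k *: v) 0 (df _ _).
have d2 := @is_derive_line f p v (k * 0) (df _ _).
have d3 : is_derive (0 : R) 1 (fun t : R => k * t) k.
  by apply: is_derive_eq; rewrite /GRing.scale/= mulr1.
have d4 := is_derive1_comp d2 d3.
rewrite mulr0 !scale0r !addr0 in d1 d2 d4.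
have E : (fun t : R => f (p + t *: (k *: v))) =
    (fun t => f (p + t *: v)) \o (fun t => k * t).
  by apply/funext => t /=; rewrite scalerA mulrC.
by rewrite -(@derive_val _ _ _ _ _ _ _ d1) E (@derive_val _ _ _ _ _ _ _ d4) mulrC.
Qed.

(** The increment along v + w is the increment along v followed by the one along w
from the moving point p + h v. The mean value theorem turns the latter into a
value of 'D_w f near p, and 'D_w f is continuous. *)
Lemma deriveD_direction f p v w : c1 f ->
  'D_(v + w) f p = 'D_v f p + 'D_w f p.
Proof.
move=> [cf df cdf]; apply/cvg_lim => //.
have dv : (fun h : R => h^-1 *: ((f \o shift p) (h *: v) - f p)) h @[h --> 0^'] -->
   'D_v f p by exact: df.
have dw : (fun h : R => h^-1 *: (f (h *: w + (h *: v + p)) - f (h *: v + p))) h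
   @[h --> 0^'] --> 'D_w f p.
  apply/cvgrPdist_lt => e e0.
  have /cvgrPdist_lt/(_ e e0) : 'D_w f z @[z --> p] --> 'D_w f p by exact: cdf.
  move=> /nbhs_ballP[d /= d0 Hd].
  pose K := `|v| + `|w| + 1.
  have K0 : 0 < K by rewrite /K addrC ltr_pwDl.
  near=> h.
  have h0 : h != 0 by near: h; exact: nbhs_dnbhs_neq.
  have hd : `|h| * K < d.
    rewrite -ltr_pdivlMr//; near: h; apply: dnbhs0_lt; exact: divr_gt0.
  (* mean value theorem on the segment from h v to h v + h w *)
  have [z /andP[z0 z1] ->] : exists2 z, 0 <= z <= 1 &
      f (h *: w + (h *: v + p)) - f (h *: v + p) = h * 'D_w f (p + h *: v + (z * h) *: w).
    pose g (t : R) := f (p + h *: v + t *: (h *: w)).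
    have dg (t : R) : is_derive t 1 g ('D_(h *: w) f (p + h *: v + t *: (h *: w))).
      by apply: is_derive_line; exact: df.
    have [|z] := @MVT R g (fun t => 'D_(h *: w) f (p + h *: v + t *: (h *: w))) 0 1 ltr01 (fun x _ => dg x).
      apply: continuous_subspaceT => t; apply: differentiable_continuous.
      by apply/derivable1_diffP; have [] := dg t.
    rewrite in_itv/= subr0 mulr1 => /andP[z0 z1] E.
    exists z; first by rewrite !ltW.
    move: E; rewrite /g scale1r scale0r addr0 => E.
    rewrite (_ : h *: w + (h *: v + p) = p + h *: v + h *: w); last by rewrite addrC [p + _]addrC.
    rewrite [h *: v + p]addrC E scalerA.
    exact: deriveZ_direction.
  rewrite /GRing.scale/= mulKf//; apply: Hd.
  rewrite -ball_normE/=; apply: le_lt_trans hd.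
  rewrite -addrA opprD addNKr normrN.
  rewrite (le_trans (ler_normD _ _))// !normrZ /K !mulrDr mulr1. rewrite (ger0_norm z0).
  by rewrite -addrA lerD2l -[leLHS]addr0 lerD// -mulrA ler_piMl// mulr_ge0.
rewrite (_ : (fun h => _) = (fun h : R => h^-1 *: (f (h *: w + (h *: v + p)) - f (h *: v + p)))
   \+ (fun h : R => h^-1 *: ((f \o shift p) (h *: v) - f p))); last first.
  apply/funext => h /=; rewrite -scalerDr addrA subrK; congr (_ *: (f _ - _)).
  by rewrite scalerDr addrCA addrA.
by rewrite addrC; exact: (cvgD dw dv).
Unshelve. all: end_near. Qed.

(** Affine functions and their exponentials are differentiated through this
reduction to one real variable. *)
Lemma is_derive_from_line f p v (d : R) :
  is_derive (0 : R) 1 (fun t : R => f (p + t *: v)) d -> is_derive p v f d.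
Proof.
have E : (fun h : R => h^-1 *: (((fun t => f (p + t *: v)) \o shift 0) (h *: 1) -
      f (p + 0 *: v))) = (fun h => h^-1 *: ((f \o shift p) (h *: v) - f p)).
  apply/funext => h /=; rewrite scale0r !addr0; congr (_ *: (f _ - _)).
  by rewrite addrC /GRing.scale/= mulr1.
by move=> [dl dE]; apply: DeriveDef; [rewrite /derivable -E|rewrite /derive -E].
Qed.

Lemma is_derive_affine f p v (d : R) :
  (forall t : R, f (p + t *: v) = f p + t * d) -> is_derive p v f d.
Proof.
move=> fE; apply: is_derive_from_line.
rewrite (_ : (fun t => _) = (fun t => f p + t * d)); last exact/funext.
by apply: is_derive_eq; rewrite /GRing.scale/= mulr0 !add0r mul1r mulr1.
Qed.

Lemma c1_smooth f : smooth f -> c1 f.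
Proof.
move=> sf; split; first exact: (sf [::]).1.
  by move=> p v; exact: (sf [::]).2.
by move=> v; exact: (sf [:: v]).1.
Qed.

Lemma deriveM_c1 f g p v : c1 f -> c1 g ->
  'D_v (fun q => f q * g q) p = f p * 'D_v g p + g p * 'D_v f p.
Proof. by move=> [_ df _] [_ dg _]; rewrite deriveM. Qed.

Lemma c1M f g : c1 f -> c1 g -> c1 (fun p => f p * g p).
Proof.
move=> c1f c1g; have [cf df cdf] := c1f; have [cg dg cdg] := c1g; split.
- by move=> p; apply: cvgM; [exact: cf|exact: cg].
- by move=> p v; exact: derivableM.
- move=> v; rewrite (_ : 'D_v _ = fun p => f p * 'D_v g p + g p * 'D_v f p).
    move=> p; apply: cvgD; apply: cvgM;
      [exact: cf|exact: cdg|exact: cg|exact: cdf].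
  by apply/funext => p; rewrite deriveM_c1.
Qed.

Lemma continuous_dot (e : R * R) : continuous (dot e).
Proof.
move=> p; apply: cvgD; apply: cvgM; try exact: cvg_cst.
  exact: cvg_fst.
exact: cvg_snd.
Qed.

Lemma is_derive_affine_form (e : R * R) (b : R) p v :
  is_derive p v (fun p => dot e p + b) (dot e v).
Proof. by apply: is_derive_affine => t; rewrite /dot/= /GRing.scale/=; ring. Qed.

Lemma derive_affine (e : R * R) (b : R) p v :
  'D_v (fun p => dot e p + b) p = dot e v.
Proof. exact: (derive_val (is_derive := is_derive_affine_form e b p v)). Qed.

Lemma c1_affine (e : R * R) (b : R) : c1 (fun p => dot e p + b).
Proof.
split.
- by move=> p; apply: cvgD; [exact: continuous_dot|exact: cvg_cst].
- by move=> p v; have [] := is_derive_affine_form e b p v.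
- move=> v; rewrite (_ : 'D_v _ = cst (dot e v)); first exact: cst_continuous.
  by apply/funext => p; exact: derive_affine.
Qed.

Lemma derive_comp_affine f (L : R * R -> R * R) (l : R * R -> R * R) p v :
  (forall q (t : R), L (q + t *: v) = L q + t *: l v) ->
  'D_v (f \o L) p = 'D_(l v) f (L p).
Proof.
move=> LE; rewrite /derive.
rewrite (_ : (fun h => _) = (fun h : R => h^-1 *: ((f \o shift (L p)) (h *: l v)
    - f (L p))))//.
apply/funext => h /=; congr (_ *: (f _ - _)).
by rewrite addrC LE addrC.
Qed.

Lemma c1_comp_affine f (L : R * R -> R * R) (l : R * R -> R * R) :
  continuous L -> (forall q v (t : R), L (q + t *: v) = L q + t *: l v) ->
  c1 f -> c1 (f \o L).
Proof.
move=> cL LE [cf df cdf]; split.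
- by move=> p; apply: continuous_comp; [exact: cL|exact: cf].
- move=> p v; have := df (L p) (l v); rewrite /derivable.
  rewrite (_ : (fun h => _) = (fun h : R => h^-1 *: ((f \o L \o shift p) (h *: v)
      - (f \o L) p)))//.
  apply/funext => h /=; congr (_ *: (f _ - _)).
  by rewrite [_ *: v + p]addrC LE addrC.
- move=> v; rewrite (_ : 'D_v _ = 'D_(l v) f \o L).
    by move=> p; apply: continuous_comp; [exact: cL|exact: cdf].
  by apply/funext => p /=; exact: derive_comp_affine.
Qed.

End C1.

(** * Affine change of variables *)
Section Chart.
Context {R : realType}.
Local Notation mu := (@lebesgue_measure R).
Local Notation plane := (measurableTypeR R * measurableTypeR R)%type.

Variables (k l m h : R).
Hypotheses (k0 : 0 < k) (h0 : 0 < h).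

(** An affine map whose second column is horizontal. For fixed [q.1] it acts on
[q.2] as a one-dimensional affine map, which is what the computation of measures
by sections needs; every triangle of the family is the image of the reference
triangle by a map of this form, because one of its sides is horizontal. *)
Definition shear (q : plane) : plane := (l + m * q.1 + k * q.2, h * q.1).

Lemma measurable_shear : measurable_fun setT shear.
Proof.
have m1 : measurable_fun setT (fst : plane -> measurableTypeR R) by exact: measurable_fst.
have m2 : measurable_fun setT (snd : plane -> measurableTypeR R) by exact: measurable_snd.
apply/measurable_fun_pairP; split => /=.
  apply: measurable_funD; last exact: measurable_funM.
  by apply: measurable_funD => //; exact: measurable_funM.
exact: measurable_funM.
Qed.

(** The right side is a measure, so by uniqueness of the product measure A may be
taken to be a rectangle X `*` Y. The section of its preimage at [q.1] is the
preimage of X by an affine map if [h * q.1] lies in Y, and is empty otherwise. *)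
Lemma leb2_shear (A : set plane) : measurable A ->
  (leb2 A = (k * h)%:E * leb2 (shear @^-1` A))%E.
Proof.
move=> mA; have kh0 : 0 <= k * h by rewrite mulr_ge0// ltW.
pose nu : {measure set plane -> \bar R} :=
  mscale (NngNum kh0) (pushforward leb2 shear).
apply: (@product_measure_unique _ _ _ _ _ _ _ (nu measurable_shear)) => //.
move=> X Y mX mY; rewrite /nu /= /mscale/= /pushforward.
have mhY : measurable ((fun x : measurableTypeR R => h * x + 0 : measurableTypeR R) @^-1` Y).
  rewrite -[X in measurable X]setTI.
  suff : measurable_fun setT (fun x : measurableTypeR R => h * x + 0 : measurableTypeR R) by exact.
  by apply: measurable_funD => //; exact: measurable_funM.
transitivity ((k * h)%:E * \int[mu]_q1 mu (xsection (shear @^-1` (X `*` Y)) q1))%E => //.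
rewrite (eq_integral (fun q1 : measurableTypeR R => (k^-1)%:E * mu X * (\1_((fun x => h * x + 0) @^-1` Y) q1)%:E)%E); last first.
  move=> q1 _ /=; rewrite indicE.
  have := @lebesgue_measure_affine R k (l + m * q1) X k0 mX.
  set B := _ @^-1` X => <-.
  rewrite muleA -EFinM mulVf ?gt_eqF// mul1e.
  case: (boolP (q1 \in _)) => hq; rewrite ?mule1 ?mule0.
    congr (mu _); apply/seteqP; split => q2; rewrite /xsection/= in_setE/=.
      by move=> [+ _]; rewrite /B/= addrC.
    move: hq; rewrite in_setE/= addr0 => hq.
    by rewrite /B/= addrC.
  rewrite (_ : xsection _ _ = set0) ?measure0//.
  apply/seteqP; split => q2 //; rewrite /xsection/= in_setE/= => -[_ /= hy].
  by move: hq; rewrite notin_setE/= addr0.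
rewrite ge0_integralZl//.
- rewrite integral_indic// setIT.
  rewrite -[in RHS](@lebesgue_measure_affine R h 0 Y h0 mY).
  rewrite !muleA; congr (_ * _)%E.
  rewrite -muleA [(mu X * _)%E]muleC muleA -!EFinM. congr (_%:E * _)%E.
  by rewrite mulrAC mulfV ?mul1r// gt_eqF.
- by apply/measurable_EFinP; exact: measurable_indic.
- by rewrite mule_ge0 ?measure_ge0// lee_fin invr_ge0 ltW.
Qed.

(** The positive and the negative part are transported separately; integrability
is what allows them to be recombined. *)
Lemma Rintegral_shear (D : set plane) (f : plane -> R) :
  measurable D -> measurable_fun setT f ->
  leb2.-integrable (shear @^-1` D) (EFin \o f \o shear) ->
  \int[leb2]_(p in D) f p = k * h * \int[leb2]_(q in shear @^-1` D) f (shear q).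
Proof.
move=> mD mf If; have kh0 : 0 <= k * h by rewrite mulr_ge0// ltW.
have mD' : measurable (shear @^-1` D).
  by rewrite -[X in measurable X]setTI; exact: measurable_shear.
pose nu : {measure set plane -> \bar R} := pushforward leb2 shear.
have ge0 (g : plane -> \bar R) : measurable_fun setT g -> (forall p, 0 <= g p)%E ->
    (\int[leb2]_(p in D) g p =
     (k * h)%:E * \int[leb2]_(q in shear @^-1` D) g (shear q))%E.
  move=> mg g0; rewrite (eq_measure_integral (mscale (NngNum kh0) (nu measurable_shear))).
    have mgD : measurable_fun D g by exact: measurable_funS mg.
    have E := @ge0_integral_mscale _ _ _ (nu measurable_shear) D mD (NngNum kh0) g mgD (fun x _ => g0 x).
    apply: (etrans E).
    have E2 := @ge0_integral_pushforward _ _ _ _ _ _ measurable_shear leb2 D g mD mgD (fun x _ => g0 x).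
    by apply: congr1; exact: E2.
  by move=> A mA _; exact: leb2_shear.
have mEf : measurable_fun setT (EFin \o f) by exact/measurable_EFinP.
pose g := EFin \o f \o shear.
have EP : (\int[leb2]_(p in D) (EFin \o f)^\+ p =
    (k * h)%:E * \int[leb2]_(q in shear @^-1` D) g^\+ q)%E.
  rewrite ge0; [|exact: measurable_funepos|by []].
  by congr (_ * _)%E; apply: eq_integral => q _; rewrite /g (funepos_comp (EFin \o f) shear).
have EQ : (\int[leb2]_(p in D) (EFin \o f)^\- p =
    (k * h)%:E * \int[leb2]_(q in shear @^-1` D) g^\- q)%E.
  rewrite ge0; [|exact: measurable_funeneg|by []].
  by congr (_ * _)%E; apply: eq_integral => q _; rewrite /g (funeneg_comp (EFin \o f) shear).
have fP := integrable_pos_fin_num mD' If; have fQ := integrable_neg_fin_num mD' If.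
have key (x y : \bar R) : x \is a fin_num -> y \is a fin_num ->
    fine ((k * h)%:E * x - (k * h)%:E * y)%E = k * h * fine (x - y)%E.
  by move: x y => [x||] [y||] //= _ _; rewrite mulrBr.
suff : fine (\int[leb2]_(p in D) (EFin \o f) p)%E =
  k * h * fine (\int[leb2]_(q in shear @^-1` D) g q)%E by [].
by rewrite integralE EP EQ key// -integralE.
Qed.

End Chart.

Section Bounded.
Context {R : realType}.
Local Notation mu := (@lebesgue_measure R).
Local Notation plane := (measurableTypeR R * measurableTypeR R)%type.

Lemma continuous_integrable_plane (M : R) (D : set plane) (f : R * R -> R) :
  measurable D -> (forall p, D p -> `|p.1| <= M /\ `|p.2| <= M) ->
  continuous f -> leb2.-integrable D (EFin \o f).
Proof.
move=> mD DM cf.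
have DK : D `<=` `[- M, M] `*` `[- M, M].
  by move=> p /DM[h1 h2]; split; rewrite /= in_itv/= -ler_norml.
apply: measurable_bounded_integrable => //.
- apply: (@le_lt_trans _ _ (leb2 (`[- M, M] `*` `[- M, M]))).
    by apply: le_measure => //; rewrite inE//; exact: measurableX.
  have -> : leb2 (`[- M, M]%classic `*` `[- M, M]%classic) =
      mule (mu `[- M, M]) (mu `[- M, M]) by exact: product_measure1E.
  rewrite lebesgue_measure_itv/=.
  by case: ifP => _; rewrite ?mule0// -EFinB -EFinM ltry.
- exact: continuous_plane_measurable.
- have /compact_bounded : compact (f @` (`[- M, M] `*` `[- M, M])).
    apply: continuous_compact; first exact: continuous_subspaceT.
    by apply: compact_setX; exact: segment_compact.
  case=> B [Br HB]; exists B; split=> // x Bx p Dp /=.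
  by apply: (HB x Bx); exists p => //; exact: DK.
Qed.

Lemma open_halfplane (e : R * R) (b : R) : open [set p | b < dot e p].
Proof.
rewrite [X in open X](_ : _ = dot e @^-1` `]b, +oo[); last first.
  by apply/seteqP; split => p /=; rewrite in_itv/= andbT.
by apply: open_comp => // p _; exact: continuous_dot.
Qed.

End Bounded.

(** * Divergence on the reference triangle *)
Section Reference.
Context {R : realType}.
Local Notation mu := (@lebesgue_measure R).
Local Notation plane := (measurableTypeR R * measurableTypeR R)%type.

Definition reference_triangle : set (R * R) :=
  [set q | [/\ 0 < q.1, 0 < q.2 & q.1 + q.2 < 1]].

Lemma open_reference_triangle : open reference_triangle.
Proof.
rewrite (_ : reference_triangle = [set p | 0 < dot (1, 0) p] `&`
   ([set p | 0 < dot (0, 1) p] `&` [set p | - 1 < dot (-1, -1) p])).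
  by apply: openI; [|apply: openI]; exact: open_halfplane.
apply/seteqP; split => [[x y]|[x y]] /=; rewrite /dot/=.
  by move=> [/= x0 y0 xy]; do! split; lra.
by move=> [x0 [y0 xy]]; split => /=; lra.
Qed.

Lemma measurable_reference_triangle : measurable (reference_triangle : set plane).
Proof. by apply: open_plane_measurable; exact: open_reference_triangle. Qed.

Lemma reference_triangle_bounded (q : R * R) : reference_triangle q ->
  `|q.1| <= 1 /\ `|q.2| <= 1.
Proof.
by move=> [q1 q2 q12]; split; rewrite ger0_norm; lra.
Qed.

Lemma continuous_EFin_measurable (f : R -> R) (D : set R) : measurable D -> continuous f ->
  measurable_fun (D : set (measurableTypeR R)) (EFin \o f).
Proof.
move=> mD cf; apply/measurable_EFinP; apply: (measurable_funS measurableT) => //.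
exact: continuous_measurable_fun.
Qed.

Lemma integral_derivative (g g' : R -> R) (a b : R) : a < b ->
  (forall x : R, is_derive x (1 : R) g (g' x)) -> continuous g' ->
  (\int[mu]_(x in `]a, b[) (g' x)%:E = (g b - g a)%:E)%E.
Proof.
move=> ab dg cg'.
have cg : continuous g.
  move=> x; apply: differentiable_continuous; apply/derivable1_diffP.
  by have [] := dg x.
rewrite -(@integral_itv_bndoo _ a b (EFin \o g') true false); last first.
  exact: continuous_EFin_measurable.
rewrite (@continuous_FTC2 _ _ g)//.
- exact: continuous_subspaceT.
- split.
  + by move=> x _; have [] := dg x.
  + by apply: cvg_at_right_filter; exact: cg.
  + by apply: cvg_at_left_filter; exact: cg.
- by move=> x _; rewrite derive1E; exact: (derive_val (is_derive := dg x)).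
Qed.

(** In the application s is the identity or the exchange of coordinates, so that
both orders of integration are covered. *)
Lemma integral_reference_section (f : R * R -> R) (H : R -> R) (s : R -> R -> R * R) :
  (forall x y, reference_triangle (s x y) <-> reference_triangle (x, y)) ->
  (forall y : R, (0 < y < 1)%R -> \int[mu]_(x in `]0%R, (1 - y)%R[) (f (s x y))%:E = (H y)%:E)%E ->
  (\int[mu]_y \int[mu]_x ((f \_ reference_triangle) (s x y))%:E =
   \int[mu]_(y in `]0%R, 1%R[) (H y)%:E)%E.
Proof.
move=> sE fH; rewrite [RHS]integral_mkcond; apply: eq_integral => y _.
rewrite [RHS]patchE; case: ifPn => [|]; rewrite ?inE ?notin_setE/= in_itv/=.
  move=> y01; rewrite -fH// [RHS]integral_mkcond; apply: eq_integral => x _.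
  rewrite !patchE; case: ifPn; case: ifPn => //; rewrite ?inE ?notin_setE/= in_itv/=.
    by move=> h /sE[/= x0 y0 xy]; case: h; lra.
  by move=> h []; apply/sE; split => /=; lra.
move=> y01; apply: integral0_eq => x _; rewrite patchE ifF//.
apply/negbTE; rewrite notin_setE => /sE[/= x0 y0 xy]; apply: y01; lra.
Qed.

Variable f : R * R -> R.
Hypothesis cf : continuous f.

Lemma integrable_reference_triangle :
  leb2.-integrable (reference_triangle : set plane) (EFin \o f).
Proof.
apply: (@continuous_integrable_plane _ 1) => //.
  exact: measurable_reference_triangle.
exact: reference_triangle_bounded.
Qed.

Let If : leb2.-integrable setT (EFin \o (f \_ reference_triangle)).
Proof.
rewrite -restrict_EFin; apply/(@integrable_mkcond _ _ _ leb2 reference_triangle (EFin \o f)).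
  exact: measurable_reference_triangle.
exact: integrable_reference_triangle.
Qed.

Lemma integral_reference_horizontal (H : R -> R) :
  (forall y : R, (0 < y < 1)%R -> \int[mu]_(x in `]0%R, (1 - y)%R[) (f (x, y))%:E = (H y)%:E)%E ->
  \int[leb2]_(p in reference_triangle) f p = \int[mu]_(y in `]0, 1[) H y.
Proof.
move=> fH; rewrite Rintegral_mkcond /Rintegral.
have /= <- := integral21_prod_meas1 If; congr fine.
exact: (@integral_reference_section f H (fun x y => (x, y))).
Qed.

Lemma integral_reference_vertical (H : R -> R) :
  (forall x : R, (0 < x < 1)%R -> \int[mu]_(y in `]0%R, (1 - x)%R[) (f (x, y))%:E = (H x)%:E)%E ->
  \int[leb2]_(p in reference_triangle) f p = \int[mu]_(x in `]0, 1[) H x.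
Proof.
move=> fH; rewrite Rintegral_mkcond /Rintegral.
have /= <- := integral12_prod_meas1 If; congr fine.
apply: (@integral_reference_section f H (fun y x => (x, y))) => //.
by move=> x y; rewrite /reference_triangle/=; split => -[h1 h2 h3]; split => //=; lra.
Qed.

End Reference.

Section ReferenceDivergence.
Context {R : realType}.
Local Notation mu := (@lebesgue_measure R).
Local Notation plane := (measurableTypeR R * measurableTypeR R)%type.

Lemma reference_derive1 (f : R * R -> R) : c1 f ->
  \int[leb2]_(p in reference_triangle) 'D_((1, 0) : R * R) f p =
  \int[mu]_(y in `]0, 1[) (f (1 - y, y) - f (0, y)).
Proof.
move=> [cf df cdf]; apply: (integral_reference_horizontal (cdf _)) => y /andP[y0 y1].
apply: (integral_derivative (g := fun x => f (x, y))); first lra.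
- move=> x; have E (t : R) : (0, y) + t *: (1, 0) = (t, y) :> R * R.
    by congr pair; rewrite /= ?scaler0 ?addr0// add0r [LHS]mulr1.
  have d := @is_derive_line R f (0, y) (1, 0) x (df _ _); rewrite E in d.
  have <- : (fun t : R => f ((0, y) + t *: (1, 0))) = (fun t => f (t, y)).
    by apply/funext => t; rewrite E.
  exact: d.
- move=> x; apply: (@continuous_comp _ _ _ (fun x : R => (x, y)) ('D_(1, 0) f) x); last exact: cdf.
  exact: (@cvg_pair R R R (nbhs x) (nbhs x) (nbhs y) _ _ _ id (cst y) cvg_id (cvg_cst _)).
Qed.

Lemma reference_derive2 (f : R * R -> R) : c1 f ->
  \int[leb2]_(p in reference_triangle) 'D_((0, 1) : R * R) f p =
  \int[mu]_(x in `]0, 1[) (f (x, 1 - x) - f (x, 0)).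
Proof.
move=> [cf df cdf]; apply: (integral_reference_vertical (cdf _)) => x /andP[x0 x1].
apply: (integral_derivative (g := fun y => f (x, y))); first lra.
- move=> y; have E (t : R) : (x, 0) + t *: (0, 1) = (x, t) :> R * R.
    by congr pair; rewrite /= ?scaler0 ?addr0// add0r [LHS]mulr1.
  have d := @is_derive_line R f (x, 0) (0, 1) y (df _ _); rewrite E in d.
  have <- : (fun t : R => f ((x, 0) + t *: (0, 1))) = (fun t => f (x, t)).
    by apply/funext => t; rewrite E.
  exact: d.
- move=> y; apply: (@continuous_comp _ _ _ (fun y : R => (x, y)) ('D_(0, 1) f) y); last exact: cdf.
  exact: (@cvg_pair R R R (nbhs y) (nbhs x) (nbhs y) _ _ _ (cst x) id (cvg_cst _) cvg_id).
Qed.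

End ReferenceDivergence.

(** * Divergence theorem on a triangle *)
Section UnitInterval.
Context {R : realType}.
Local Notation mu := (@lebesgue_measure R).

Lemma continuous_line (p v : R * R) : continuous (fun t : R => p + t *: v).
Proof.
by move=> t; apply: cvgD; [exact: cvg_cst|apply: cvgZr_tmp; exact: cvg_id].
Qed.

Lemma integrable_unit (b0 b1 : bool) (g : R -> R) : continuous g ->
  mu.-integrable [set` Interval (BSide b0 0) (BSide b1 1)] (EFin \o g).
Proof.
move=> cg; have : mu.-integrable `[0, 1] (EFin \o g).
  apply: continuous_compact_integrable; first exact: segment_compact.
  exact: continuous_subspaceT.
apply: integrableS => //; by case: b0; case: b1 => x /=; rewrite !in_itv/=; lra.
Qed.

Lemma Rintegral_unit_oo (g : R -> R) : continuous g ->
  \int[mu]_(t in `]0, 1[) g t = \int[mu]_(t in `[0, 1]) g t.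
Proof.
move=> cg; rewrite /Rintegral; congr fine; apply/esym.
apply: (@integral_itv_bndoo _ 0 1 (EFin \o g) true false).
exact: continuous_EFin_measurable.
Qed.

Lemma Rintegral_unit_onem (g : R -> R) : continuous g ->
  \int[mu]_(t in `[0, 1]) g (1 - t) = \int[mu]_(t in `[0, 1]) g t.
Proof.
move=> cg; apply/esym.
have := @Rintegration_by_substitution_onem R g 1; rewrite /unstable.onem subrr => -> //.
  by rewrite ler01 lexx.
exact: continuous_subspaceT.
Qed.

End UnitInterval.

Section TriangleDivergence.
Context {R : realType}.
Local Notation mu := (@lebesgue_measure R).
Local Notation plane := (measurableTypeR R * measurableTypeR R)%type.

Definition i0 : 'I_3 := ord0.
Definition i1 : 'I_3 := Ordinal (isT : 1 < 3)%N.
Definition i2 : 'I_3 := Ordinal (isT : 2 < 3)%N.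

Lemma sum_I3 (V : nmodType) (F : 'I_3 -> V) : \sum_i F i = F i0 + F i1 + F i2.
Proof.
rewrite !big_ord_recl big_ord0 addr0 addrA.
by congr (F _ + F _ + F _); exact: val_inj.
Qed.

Lemma ordS_I3 : (ordS i0 = i1) * (ordS i1 = i2) * (ordS i2 = i0).
Proof. by do ?split; exact: val_inj. Qed.

Lemma ord_pred_I3 : (ord_pred i0 = i2) * (ord_pred i1 = i0) * (ord_pred i2 = i1).
Proof. by do ?split; exact: val_inj. Qed.

Lemma I3P (P : 'I_3 -> Prop) : P i0 -> P i1 -> P i2 -> forall i, P i.
Proof.
move=> P0 P1 P2 [[|[|[|//]]] Hi].
- by rewrite (_ : Ordinal Hi = i0); last exact: val_inj.
- by rewrite (_ : Ordinal Hi = i1); last exact: val_inj.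
- by rewrite (_ : Ordinal Hi = i2); last exact: val_inj.
Qed.

Variables (S a c : R).
Hypotheses (S0 : 0 < S) (c0 : 0 < c).
Local Notation T := (triangle S a c).
Local Notation chart := (shear (2 * c) (- c) (a + c) (S / c)).

Let h0 : 0 < S / c. Proof. exact: divr_gt0. Qed.
Let k0 : 0 < 2 * c. Proof. by rewrite mulr_gt0. Qed.

Lemma triangleE : (T i0 = (- c, 0)) * (T i1 = (c, 0)) * (T i2 = (a, S / c)).
Proof. by []. Qed.

Definition unchart (p : R * R) : R * R :=
  (dot (0, (S / c)^-1) p + 0,
   dot ((2 * c)^-1, - ((a + c) / (2 * c * (S / c)))) p + 2^-1).

Lemma chartK : cancel chart unchart.
Proof.
move=> [s t]; rewrite /unchart /shear /dot/=; congr pair; field;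
  by rewrite !gt_eqF.
Qed.

Lemma unchartK : cancel unchart chart.
Proof.
move=> [s t]; rewrite /unchart /shear /dot/=; congr pair; field;
  by rewrite !gt_eqF.
Qed.

Lemma open_triangle_chart : open_triangle T = unchart @^-1` reference_triangle.
Proof.
apply/seteqP; split => [_ [t [t0 t1 ->]]|p] /=.
  rewrite !sum_I3 !triangleE in t1 *.
  have -> : t i0 *: (- c, 0) + t i1 *: (c, 0) + t i2 *: (a, S / c) =
      chart (t i2, t i1) :> R * R.
    rewrite /shear; congr pair => /=; rewrite /GRing.scale/=.
      have -> : t i0 = 1 - t i1 - t i2 by rewrite -t1; ring.
      by ring.
    by rewrite !mulr0 !add0r mulrC.
  rewrite chartK; split => //=; rewrite -t1.
  by have := t0 i0; lra.
rewrite -{2}[p]unchartK; case: (unchart p) => x y [/= x0 y0 xy].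
exists (nth 0 [:: 1 - x - y; y; x]); rewrite !sum_I3 !triangleE /=; split.
- by apply: I3P => //=; lra.
- by ring.
- by rewrite /shear; congr pair => /=; rewrite /GRing.scale/=; ring.
Qed.

Lemma continuous_affine_pair (e e' : R * R) (b b' : R) :
  continuous (fun p => (dot e p + b, dot e' p + b')).
Proof.
move=> p; apply: (@cvg_pair (R * R)%type R R (nbhs p) (nbhs _) (nbhs _)).
  by have [+ _ _] := c1_affine e b; exact.
by have [+ _ _] := c1_affine e' b'; exact.
Qed.

Lemma open_open_triangle : open (open_triangle T).
Proof.
rewrite open_triangle_chart; apply: open_comp.
  by move=> p _; exact: continuous_affine_pair.
exact: open_reference_triangle.
Qed.

Lemma measurable_open_triangle : measurable (open_triangle T : set plane).
Proof. by apply: open_plane_measurable; exact: open_open_triangle. Qed.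

Lemma preimage_chart : chart @^-1` open_triangle T = reference_triangle.
Proof.
by rewrite open_triangle_chart; apply/seteqP; split => q /=; rewrite chartK.
Qed.

Lemma open_triangle_bounded : exists M, forall p, open_triangle T p ->
  `|p.1| <= M /\ `|p.2| <= M.
Proof.
exists (c + `|a + c| + 2 * c + S / c) => p; rewrite open_triangle_chart /=.
rewrite -{2 3}[p]unchartK; case: (unchart p) => x y [/= x0 y0 xy].
have x1 : `|x| <= 1 by rewrite ger0_norm; lra.
have y1 : `|y| <= 1 by rewrite ger0_norm; lra.
have B : `|S / c * x| <= S / c by rewrite normrM gtr0_norm// ler_piMr// ltW.
split; last by rewrite (le_trans B)// lerDr !addr_ge0// ltW.
have B1 : `|(a + c) * x| <= `|a + c| by rewrite normrM ler_piMr.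
have B2 : `|2 * c * y| <= 2 * c by rewrite normrM (gtr0_norm k0) ler_piMr// ltW.
have B3 := ler_normD (- c + (a + c) * x) (2 * c * y).
have := ler_normD (- c) ((a + c) * x); rewrite normrN (gtr0_norm c0).
by have := h0; rewrite /shear/=; lra.
Qed.

Lemma integrable_triangle (f : R * R -> R) : continuous f ->
  leb2.-integrable (open_triangle T) (EFin \o f).
Proof.
have [M TM] := open_triangle_bounded.
by apply: (@continuous_integrable_plane _ M) => //; exact: measurable_open_triangle.
Qed.

(** As the vertices are listed counterclockwise, this is the outer normal of the
side, multiplied by the length of the side. *)
Definition side_normal (U : 'I_3 -> R * R) (i : 'I_3) : R * R :=
  let e := U (ordS i) - U i in (e.2, - e.1).

Definition side_mean (f : R * R -> R) (i : 'I_3) : R :=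
  \int[mu]_(t in `[0, 1]) f (side_point T i t).

Lemma continuous_side (f : R * R -> R) i : continuous f ->
  continuous (fun t => f (side_point T i t)).
Proof.
move=> cf t; apply: (@continuous_comp _ _ _ (side_point T i) f); last exact: cf.
exact: continuous_line.
Qed.

Lemma side_pointE (t : R) : [/\ side_point T i0 t = chart (0, t),
  side_point T i1 t = chart (t, 1 - t) & side_point T i2 t = chart (1 - t, 0)].
Proof.
by split; rewrite /side_point ordS_I3 !triangleE /shear; congr pair => /=;
  rewrite /GRing.scale/=; ring.
Qed.

(** In the chart the derivatives along the two sides issued from the first vertex
are partial derivatives on the reference triangle, whose integrals are
differences of integrals over two sides. The direction v is a combination of
these two sides, and collecting the coefficient of each side yields the product
of v with its normal. *)
Lemma divergence_triangle (f : R * R -> R) (v : R * R) : c1 f ->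
  \int[leb2]_(p in open_triangle T) 'D_v f p =
  \sum_i dot (side_normal T i) v * side_mean f i.
Proof.
move=> c1f; have [cf _ cdf] := c1f.
pose y := v.2 / (S / c); pose x := (v.1 - (a + c) * y) / (2 * c).
pose e1 : R * R := (2 * c, 0); pose e2 : R * R := (a + c, S / c).
have vE : v = x *: e1 + y *: e2.
  rewrite [LHS]surjective_pairing; congr pair => /=;
    rewrite /GRing.scale/= /x /y; field; by rewrite !gt_eqF.
pose F := f \o chart.
pose l (w : R * R) : R * R := ((a + c) * w.1 + 2 * c * w.2, S / c * w.1).
have chartE q w (t : R) : chart (q + t *: w) = chart q + t *: l w.
  by rewrite /shear /l; congr pair => /=; rewrite /GRing.scale/=; ring.
have cchart : continuous chart.
  rewrite (_ : chart = fun q => (dot (a + c, 2 * c) q + - c, dot (S / c, 0) q + 0)).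
    exact: continuous_affine_pair.
  by apply/funext => q; rewrite /shear /dot/=; congr pair; ring.
have c1F : c1 F by exact: (c1_comp_affine cchart chartE).
have [cF _ cdF] := c1F.
have mT := measurable_open_triangle; have mR := @measurable_reference_triangle R.
have DF q : 'D_v f (chart q) = x * 'D_((0, 1) : R * R) F q + y * 'D_((1, 0) : R * R) F q.
  have -> : 'D_((0, 1) : R * R) F q = 'D_e1 f (chart q).
    have -> : e1 = l (0, 1) by congr pair; rewrite /= ?mulr0 ?mulr1 ?add0r.
    exact: (@derive_comp_affine R f chart l q (0, 1) (fun q t => chartE q (0, 1) t)).
  have -> : 'D_((1, 0) : R * R) F q = 'D_e2 f (chart q).
    have -> : e2 = l (1, 0) by congr pair; rewrite /= ?mulr0 ?mulr1 ?addr0.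
    exact: (@derive_comp_affine R f chart l q (1, 0) (fun q t => chartE q (1, 0) t)).
  rewrite {1}vE (deriveD_direction _ _ _ c1f).
  by congr (_ + _); exact: deriveZ_direction.
have := @Rintegral_shear R (2 * c) (- c) (a + c) (S / c) k0 h0 _ ('D_v f) mT.
rewrite preimage_chart => ->; last 2 first.
- by apply: continuous_plane_measurable.
- apply: (@integrable_reference_triangle _ ('D_v f \o chart)) => q.
  by apply: continuous_comp; [exact: cchart|exact: cdf].
under eq_Rintegral do rewrite DF.
have I1 := integrable_reference_triangle (cdF (0, 1)).
have I2 := integrable_reference_triangle (cdF (1, 0)).
rewrite RintegralD//; last 2 first.
- exact: (integrableZl mR x I1).
- exact: (integrableZl mR y I2).
rewrite !RintegralZl// reference_derive1// reference_derive2//.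
have E0 t : F (0, t) = f (side_point T i0 t) by have [-> _ _] := side_pointE t.
have E1 t : F (t, 1 - t) = f (side_point T i1 t) by have [_ -> _] := side_pointE t.
have E2 t : F (1 - t, 0) = f (side_point T i2 t) by have [_ _ ->] := side_pointE t.
have cs i : continuous (fun t => f (side_point T i t)) by exact: continuous_side.
have c1m : continuous (fun t : R => 1 - t).
  by move=> t; apply: cvgB; [exact: cvg_cst|exact: cvg_id].
have c1s i : continuous (fun t : R => f (side_point T i (1 - t))).
  move=> t; apply: (@continuous_comp R R R (fun t : R => 1 - t)
    (fun t : R => f (side_point T i t)) t); [exact: c1m|exact: cs].
rewrite (@eq_Rintegral _ _ _ mu `]0, 1[
  (fun t : R => f (side_point T i1 t) - f (side_point T i2 (1 - t)))); last first.
  by move=> t _; rewrite E1 -E2 subKr.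
rewrite [X in _ + y * X](@eq_Rintegral _ _ _ mu `]0, 1[
  (fun t : R => f (side_point T i1 (1 - t)) - f (side_point T i0 t))); last first.
  by move=> t _; have := E1 (1 - t); rewrite subKr => ->; rewrite E0.
rewrite !RintegralB//; try exact: integrable_unit.
rewrite !Rintegral_unit_oo// (Rintegral_unit_onem (cs i1)) (Rintegral_unit_onem (cs i2)).
rewrite sum_I3 /side_normal !ordS_I3 !triangleE /dot/= -/(side_mean f i0) -/(side_mean f i1)
  -/(side_mean f i2) /x /y.
field; by rewrite !gt_eqF.
Qed.

End TriangleDivergence.

(** * Angles and bisectors *)
Section Vectors.
Context {R : realType}.
Implicit Types v w : R * R.

Definition cross v w : R := v.1 * w.2 - v.2 * w.1.

Lemma dot_ge0 v : 0 <= dot v v.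
Proof. by rewrite addr_ge0// -expr2 sqr_ge0. Qed.

Lemma sqr_norm2 v : norm2 v ^+ 2 = dot v v.
Proof. by rewrite sqr_sqrtr// dot_ge0. Qed.

Lemma norm2_ge0 v : 0 <= norm2 v.
Proof. exact: sqrtr_ge0. Qed.

Lemma norm2N v : norm2 (- v) = norm2 v.
Proof. by rewrite /norm2 /dot/= !mulrNN. Qed.

Lemma dot_cross v w : dot v w ^+ 2 + cross v w ^+ 2 = (norm2 v * norm2 w) ^+ 2.
Proof. by rewrite exprMn !sqr_norm2 /dot /cross; ring. Qed.

Definition vector_angle v w : R := acos (dot v w / (norm2 v * norm2 w)).

Variables v w : R * R.
Hypothesis vw : 0 < cross v w.

Lemma norm2_gt0l : 0 < norm2 v.
Proof.
rewrite lt_neqAle norm2_ge0 andbT; apply/eqP => v0.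
have := dot_cross v w; rewrite -v0 mul0r expr0n/= => /eqP.
by rewrite paddr_eq0 ?sqr_ge0// => /andP[_]; rewrite sqrf_eq0 gt_eqF.
Qed.

Lemma norm2_gt0r : 0 < norm2 w.
Proof.
rewrite lt_neqAle norm2_ge0 andbT; apply/eqP => v0.
have := dot_cross v w; rewrite -v0 mulr0 expr0n/= => /eqP.
by rewrite paddr_eq0 ?sqr_ge0// => /andP[_]; rewrite sqrf_eq0 gt_eqF.
Qed.

Let n0 : 0 < norm2 v * norm2 w.
Proof. by rewrite mulr_gt0 ?norm2_gt0l ?norm2_gt0r. Qed.

Lemma cosine_lt1 : -1 < dot v w / (norm2 v * norm2 w) < 1.
Proof.
rewrite -ltr_norml normrM normfV (gtr0_norm n0) ltr_pdivrMr// mul1r.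
rewrite -ltr_sqr ?nnegrE// ?ltW// real_normK ?num_real//.
by rewrite -dot_cross ltrDl exprn_gt0.
Qed.

Let cosine_bounds : -1 <= dot v w / (norm2 v * norm2 w) <= 1.
Proof. by have /andP[/ltW -> /ltW ->] := cosine_lt1. Qed.

Lemma cos_vector_angle : cos (vector_angle v w) = dot v w / (norm2 v * norm2 w).
Proof. by rewrite acosK// in_itv/=. Qed.

Lemma sin_vector_angle : sin (vector_angle v w) = cross v w / (norm2 v * norm2 w).
Proof.
rewrite sin_acos// (_ : 1 - _ = (cross v w / (norm2 v * norm2 w)) ^+ 2).
  by rewrite sqrtr_sqr ger0_norm// divr_ge0// ltW.
have := dot_cross v w => /(canRL (addKr _)) E.
rewrite !expr_div_n E; field.
by rewrite (gt_eqF norm2_gt0l) (gt_eqF norm2_gt0r).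
Qed.

Lemma vector_angle_bounds : 0 < vector_angle v w < pi.
Proof.
have /andP[h1 h2] := cosine_lt1; rewrite acos_gt0 ?acos_ltpi//.
  by rewrite h1 ltW.
by rewrite h2 ltW.
Qed.

End Vectors.

Section TriangleAngles.
Context {R : realType}.
Local Notation mu := (@lebesgue_measure R).

Lemma half_angle (x : R) : 0 < x < pi -> [/\ 0 < sin (x / 2), 0 < cos (x / 2),
  cos x = 1 - 2 * sin (x / 2) ^+ 2 & sin x = 2 * sin (x / 2) * cos (x / 2)].
Proof.
move=> /andP[x0 xpi]; have xE : x = x / 2 *+ 2 by rewrite -mulr_natr; lra.
split.
- by apply: sin_gt0_pihalf; apply/andP; split; lra.
- by apply: cos_gt0_pihalf; apply/andP; split; lra.
- by rewrite {1}xE cos_mulr2n cos2sin2 mulr2n; ring.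
- by rewrite {1}xE sin_mulr2n mulr2n; ring.
Qed.

Variables (S a c : R).
Hypotheses (S0 : 0 < S) (c0 : 0 < c).
Local Notation T := (triangle S a c).

(** Twice the area, with the sign given by the counterclockwise order. *)
Lemma cross_triangle i : cross (T (ordS i) - T i) (T (ord_pred i) - T i) = 2 * S.
Proof.
move: i; apply: I3P; rewrite ?ordS_I3 ?ord_pred_I3 !triangleE /cross/=; field;
  by rewrite gt_eqF.
Qed.

Lemma cross_triangle_gt0 i : 0 < cross (T (ordS i) - T i) (T (ord_pred i) - T i).
Proof. by rewrite cross_triangle mulr_gt0. Qed.

Lemma ordSK3 (i : 'I_3) : ordS (ord_pred i) = i.
Proof. by move: i; apply: I3P; rewrite ?ord_pred_I3 ?ordS_I3. Qed.

Lemma ordSS3 (i : 'I_3) : ordS (ordS i) = ord_pred i.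
Proof. by move: i; apply: I3P; rewrite !ordS_I3 ?ord_pred_I3. Qed.

Lemma sum_I3_at (V : nmodType) (F : 'I_3 -> V) i :
  \sum_j F j = F i + F (ordS i) + F (ord_pred i).
Proof.
move: i; apply: I3P; rewrite sum_I3 ?ordS_I3 ?ord_pred_I3//.
  by rewrite -addrA addrC.
by rewrite addrC addrA.
Qed.

Lemma side_length_gt0 i : 0 < side_length T i.
Proof. exact: norm2_gt0l (cross_triangle_gt0 i). Qed.

Lemma side_length_pred i : side_length T (ord_pred i) = norm2 (T (ord_pred i) - T i).
Proof. by rewrite /side_length ordSK3 -norm2N opprB. Qed.

(** The two sides at the vertex make the angle theta / 2 with the bisector e, which
gives the first two products; the third one follows since the three scaled
normals of a triangle add up to zero. *)
Lemma bisector i : exists e : R * R, [/\ dot e e = 1,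
  dot (side_normal T i) e = - (side_length T i * sin (angle T i / 2)),
  dot (side_normal T (ord_pred i)) e =
    - (side_length T (ord_pred i) * sin (angle T i / 2)) &
  0 <= dot (side_normal T (ordS i)) e].
Proof.
pose v := T (ordS i) - T i; pose w := T (ord_pred i) - T i.
have vw : 0 < cross v w by exact: cross_triangle_gt0.
have [s0 k0 cosE sinE] := half_angle (vector_angle_bounds vw).
rewrite (cos_vector_angle vw) in cosE; rewrite (sin_vector_angle vw) in sinE.
have nv := norm2_gt0l vw; have nw := norm2_gt0r vw.
rewrite side_length_pred -/w -[angle T i]/(vector_angle v w) -[side_length T i]/(norm2 v).
set s := sin _ in s0 cosE sinE *; set k := cos _ in k0 sinE *.
set nv' := norm2 v in nv cosE sinE *; set nw' := norm2 w in nw cosE sinE *.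
pose e := (2 * k)^-1 *: (nv'^-1 *: v + nw'^-1 *: w).
have D : cross v w = 2 * s * k * (nv' * nw').
  by rewrite -sinE divfK// mulf_neq0 ?gt_eqF.
have N1 : dot (side_normal T i) e = - (nv' * s).
  transitivity (- (cross v w / (2 * k * nw'))).
    rewrite /dot /side_normal /cross/= -/v /GRing.scale/=; field.
    by rewrite !gt_eqF.
  by rewrite D; field; rewrite !gt_eqF.
have N2 : dot (side_normal T (ord_pred i)) e = - (nw' * s).
  transitivity (- (cross v w / (2 * k * nv'))).
    rewrite /dot /side_normal /cross/= ordSK3 -opprB -/w /GRing.scale/=; field.
    by rewrite !gt_eqF.
  by rewrite D; field; rewrite !gt_eqF.
exists e; split => //.
  have Ev : dot v v = nv' ^+ 2 by rewrite sqr_norm2.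
  have Ew : dot w w = nw' ^+ 2 by rewrite sqr_norm2.
  have Evw : dot v w = (1 - 2 * s ^+ 2) * (nv' * nw').
    by rewrite -cosE divfK// mulf_neq0 ?gt_eqF.
  have sk : s ^+ 2 = 1 - k ^+ 2 by rewrite /s sin2cos2.
  transitivity ((2 * k) ^- 2 * (dot v v / nv' ^+ 2 + 2 * dot v w / (nv' * nw') +
     dot w w / nw' ^+ 2)).
    rewrite /dot/= /GRing.scale/=; field; by rewrite !gt_eqF.
  by rewrite Ev Ew Evw sk; field; rewrite !gt_eqF.
have -> : dot (side_normal T (ordS i)) e = (nv' + nw') * s.
  have : \sum_j dot (side_normal T j) e = 0.
    by rewrite sum_I3 /side_normal ?ordS_I3 !triangleE /dot/=; ring.
  by rewrite (sum_I3_at _ i) N1 N2; lra.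
by rewrite mulr_ge0 ?addr_ge0 ?ltW.
Qed.

End TriangleAngles.

(** * Upper bound by an exponential test function *)
Section L2.
Context {R : realType}.
Local Notation mu := (@lebesgue_measure R).
Local Notation plane := (measurableTypeR R * measurableTypeR R)%type.

(** Ensures that the denominator of the Rayleigh quotient is positive. *)
Lemma sqr_integral_gt0 (D : set plane) (u : plane -> R) :
  measurable D -> measurable_fun D u ->
  ~ {ae leb2, forall p, D p -> u p = 0} ->
  (0 < \int[leb2]_(p in D) (u p ^+ 2)%:E)%E.
Proof.
move=> mD mu_ Nu; rewrite lt_neqAle integral_ge0 ?andbT; last first.
  by move=> p _; rewrite lee_fin sqr_ge0.
apply/eqP => /esym I0; apply: Nu.
have /(ae_eq_integral_abs leb2 mD) : measurable_fun D (fun p => (u p ^+ 2)%:E).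
  by apply/measurable_EFinP; exact: measurable_funX.
rewrite (eq_integral (fun p => (u p ^+ 2)%:E)); last first.
  by move=> p _; rewrite gee0_abs// lee_fin sqr_ge0.
move=> [/(_ I0) + _]; apply: filterS => p /[apply] -[] /eqP.
by rewrite sqrf_eq0 => /eqP.
Qed.

End L2.

Section Exponential.
Context {R : realType}.
Implicit Types (e p v : R * R).

Definition expwave (k : R) e p : R := expR (k * dot e p).

Lemma is_derive_expwave k e p v :
  is_derive p v (expwave k e) (k * dot e v * expwave k e p).
Proof.
apply: is_derive_from_line.
have -> : (fun t : R => expwave k e (p + t *: v)) =
    expR \o (fun t => k * dot e p + t * (k * dot e v)).
  apply/funext => t /=; rewrite /expwave /dot/= /GRing.scale/=; congr expR; ring.
have d1 : is_derive (0 : R) 1 (fun t : R => k * dot e p + t * (k * dot e v)) (k * dot e v).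
  by apply: is_derive_eq; rewrite /GRing.scale/= mulr0 !add0r mul1r mulr1.
have := is_derive1_comp (is_derive_expR _) d1.
by rewrite /= mul0r addr0 [X in is_derive _ _ _ X]mulrC.
Qed.

Lemma derive_expwave k e v : 'D_v (expwave k e) = (fun p => k * dot e v * expwave k e p).
Proof. by apply/funext => p; exact: (derive_val (is_derive := is_derive_expwave k e p v)). Qed.

Lemma continuous_expwave k e : continuous (expwave k e).
Proof.
move=> p; apply: (@continuous_comp _ _ _ (fun p => k * dot e p) expR).
  by apply: cvgM; [exact: cvg_cst|exact: continuous_dot].
exact: continuous_expR.
Qed.

Lemma smooth_expwave k e : smooth (expwave k e).
Proof.
move=> vs; have [b ->] : exists b, iter_derive vs (expwave k e) = (fun p => b * expwave k e p).
  elim: vs => [|v vs [b IH]] /=; first by exists 1; apply/funext => p; rewrite mul1r.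
  exists (b * (k * dot e v)); apply/funext => p; rewrite IH.
  have := @is_deriveZ _ _ _ (expwave k e) b p v _ (is_derive_expwave k e p v).
  by move=> d; rewrite (_ : (fun p => _) = b \*: expwave k e)// (derive_val (is_derive := d)) /GRing.scale/=; ring.
split=> [p|p v].
  by apply: cvgM; [exact: cvg_cst|exact: continuous_expwave].
have := @is_deriveZ _ _ _ (expwave k e) b p v _ (is_derive_expwave k e p v).
by case.
Qed.

Lemma expwave_gt0 k e p : 0 < expwave k e p.
Proof. exact: expR_gt0. Qed.

Lemma expwave_sqr k e p : expwave k e p ^+ 2 = expwave (2 * k) e p.
Proof. by rewrite /expwave expr2 -expRD; congr expR; ring. Qed.

End Exponential.

Section UpperBound.
Context {R : realType}.
Local Notation mu := (@lebesgue_measure R).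
Local Notation plane := (measurableTypeR R * measurableTypeR R)%type.
Variables (S a c : R).
Hypotheses (S0 : 0 < S) (c0 : 0 < c).
Local Notation T := (triangle S a c).
Local Notation Omega := (open_triangle T).

Lemma leb2_triangle_gt0 : (0 < leb2 (Omega : set plane))%E.
Proof.
have mT := measurable_open_triangle a S0 c0.
have k0 : 0 < 2 * c by rewrite mulr_gt0.
have h0 : 0 < S / c by rewrite divr_gt0.
rewrite (@leb2_shear R (2 * c) (- c) (a + c) (S / c) k0 h0 _ mT).
rewrite preimage_chart//; apply: mule_gt0; first by rewrite lte_fin mulr_gt0.
pose Q : set plane := `]0, 1/2[%classic `*` `]0, 1/2[%classic.
apply: (@lt_le_trans _ _ (leb2 Q)).
  have -> : leb2 Q = mule (mu `]0, 1/2[) (mu `]0, 1/2[) by exact: product_measure1E.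
  by rewrite lebesgue_measure_itv/= lte_fin ifT -?EFinB -?EFinM ?lte_fin; lra.
apply: le_measure; rewrite ?inE.
- exact: measurableX.
- exact: measurable_reference_triangle.
- by move=> p [/=]; rewrite !in_itv/= => /andP[? ?] /andP[? ?]; split; lra.
Qed.

Lemma not_ae_zero (u : R * R -> R) : (forall p, Omega p -> u p != 0) ->
  ~ {ae leb2, forall p, Omega p -> u p = 0}.
Proof.
move=> u0 [N [mN N0 HN]]; have := leb2_triangle_gt0; apply/negP; rewrite -leNgt -N0.
apply: le_measure; rewrite ?inE//; first exact: measurable_open_triangle.
by move=> p Op; apply: HN => /= /(_ Op); exact/eqP/u0.
Qed.

Lemma boundary_integral_continuous (f : R * R -> R) : continuous f ->
  boundary_integral T f = (\sum_i side_length T i * side_mean S a c f i)%:E.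
Proof.
move=> cf; rewrite /boundary_integral -sumEFin; apply: eq_bigr => i _.
rewrite EFinM; congr (_ * _)%E; rewrite /side_mean /Rintegral fineK//.
by apply: integrable_fin_num => //; apply: (@integrable_unit R true false); exact: continuous_side.
Qed.

Lemma square_integrable_continuous (f : R * R -> R) : continuous f ->
  square_integrable leb2 Omega f.
Proof.
move=> cf; have mT := measurable_open_triangle a S0 c0; split.
  exact: continuous_plane_measurable.
apply: (integrable_lty mT); apply: (integrable_triangle a S0 c0 (f := fun p => f p ^+ 2)).
by move=> p; apply: cvgM; exact: cf.
Qed.

Lemma side_point_boundary i (t : R) : 0 <= t <= 1 -> ~ Omega (side_point T i t).
Proof.
move=> t01; rewrite open_triangle_chart// /=; have [E0 E1 E2] := side_pointE S a c t.
move: i; apply: I3P; rewrite ?E0 ?E1 ?E2 chartK// => -[/=]; lra.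
Qed.

(** For a test function phi the function u * phi vanishes on the sides, hence the
integral of its derivative is zero by the divergence theorem. *)
Lemma H1_c1 (u : R * R -> R) (G : R * R -> R * R) : c1 u ->
  (forall p v, 'D_v u p = dot (G p) v) -> H1_with_gradient Omega u G.
Proof.
move=> c1u DG; have [cu du cdu] := c1u; split.
- exact: square_integrable_continuous.
- rewrite (_ : (fun p => _) = 'D_((1, 0) : R * R) u).
    exact: square_integrable_continuous.
  by apply/funext => p; rewrite DG /dot/= mulr1 mulr0 addr0.
- rewrite (_ : (fun p => _) = 'D_((0, 1) : R * R) u).
    exact: square_integrable_continuous.
  by apply/funext => p; rewrite DG /dot/= mulr1 mulr0 add0r.
move=> phi v [sphi _ supp]; have c1p := c1_smooth sphi.
have [cp dp cdp] := c1p.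
have mT := measurable_open_triangle a S0 c0.
have I1 : leb2.-integrable Omega (EFin \o (fun p => u p * 'D_v phi p)).
  apply: integrable_triangle => // p; apply: cvgM; [exact: cu|exact: cdp].
have I2 : leb2.-integrable Omega (EFin \o (fun p => phi p * 'D_v u p)).
  apply: integrable_triangle => // p; apply: cvgM; [exact: cp|exact: cdu].
have := divergence_triangle a S0 c0 v (c1M c1u c1p).
under eq_Rintegral do rewrite deriveM_c1//.
rewrite RintegralD// big1; last first.
  move=> i _; rewrite /side_mean (@eq_Rintegral _ _ _ _ _ (cst 0)) ?Rintegral_cst// ?mul0r ?mulr0//.
  move=> t; rewrite inE/= in_itv/= => t01.
  have [->|p0] := eqVneq (phi (side_point T i t)) 0; first by rewrite mulr0.
  by case: (@side_point_boundary i t t01); apply: supp; exact: subset_closure.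
move=> /eqP; rewrite addr_eq0 => /eqP ->; congr (- _).
by apply: eq_Rintegral => p _; rewrite DG mulrC.
Qed.

(** The constant sequence u is an admissible approximation. *)
Lemma is_trace_smooth (u : R * R -> R) (G : R * R -> R * R) : smooth u ->
  (forall p v, 'D_v u p = dot (G p) v) -> is_trace T u G u.
Proof.
move=> su DG; have [cu du cdu] := c1_smooth su; split.
  split.
    move=> i; apply: (measurable_funS measurableT) => //.
    by apply: continuous_measurable_fun; exact: continuous_side.
  rewrite (boundary_integral_continuous (f := fun p => u p ^+ 2)) ?ltry// => p.
  by apply: cvgM; exact: cu.
exists (fun=> u); split => //.
- under eq_fun do under eq_integral do rewrite subrr expr0n/=.
  by rewrite integral0; exact: cvg_cst.
- under eq_fun do under eq_integral do
    rewrite !DG /dot/= !mulr0 !mulr1 addr0 add0r !subrr expr0n/= addr0.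
  by rewrite integral0; exact: cvg_cst.
- rewrite (_ : (fun n => _) = cst 0%E); first exact: cvg_cst.
  apply/funext => n; rewrite /boundary_integral big1// => i _.
  by rewrite integral0_eq ?mule0// => t _; rewrite subrr expr0n.
Qed.

(** The test function is u = exp (k e.p) with k = alpha / sin (theta / 2) < 0, and
its gradient is k u e. The divergence theorem for u^2 in the direction e reads
  2 k int u^2 = - sin (theta / 2) (boundary terms of the two sides at the vertex)
                + (nonnegative term of the opposite side),
so the boundary term alpha int_boundary u^2 is at most - 2 k^2 int u^2, while the
gradient term equals k^2 int u^2. *)
Lemma robin_eigenvalue_le (alpha : R) i : alpha < 0 ->
  (robin_eigenvalue alpha T <= (- (alpha ^+ 2 / sin (angle T i / 2) ^+ 2))%:E)%E.
Proof.
move=> alpha0; have [e [ee N1 N2 N3]] := bisector a S0 c0 i.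
have [s0 _ _ _] := half_angle (vector_angle_bounds (cross_triangle_gt0 a S0 c0 i)).
rewrite -/(angle T i) in s0.
set s := sin _ in s0 N1 N2 *.
pose k := alpha / s; pose u := expwave k e.
pose G p : R * R := (k * u p) *: e.
have DG (p v : R * R) : 'D_v u p = dot (G p) v.
  have := congr1 (@^~ p) (derive_expwave k e v); rewrite /u => ->.
  by rewrite /G /u /dot/= /GRing.scale/=; ring.
have su : smooth u := smooth_expwave k e.
have c1u := c1_smooth su; have [cu _ _] := c1u.
have mT := measurable_open_triangle a S0 c0.
have cu2 : continuous (fun p => u p ^+ 2) by move=> p; apply: cvgM; exact: cu.
have Nu : ~ {ae leb2, forall p, Omega p -> u p = 0}.
  by apply: not_ae_zero => p _; rewrite gt_eqF// expwave_gt0.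
pose A := \int[leb2]_(p in Omega) (u p ^+ 2).
have A0 : 0 < A.
  have mu_ : measurable_fun (Omega : set plane) u by exact: continuous_plane_measurable.
  have := sqr_integral_gt0 mT mu_ Nu.
  have If := integrable_triangle a S0 c0 cu2.
  by rewrite -lte_fin /A /Rintegral fineK//; exact: (integrable_fin_num mT If).
apply: (@le_trans _ _ (robin_quotient alpha T u G u)%:E).
  apply: ereal_inf_lbound; exists u, G, u; split => //.
    exact: H1_c1.
  exact: is_trace_smooth.
rewrite lee_fin /robin_quotient -/A ler_pdivrMr// boundary_integral_continuous//=.
have -> : \int[leb2]_(p in Omega) dot (G p) (G p) = k ^+ 2 * A.
  rewrite -RintegralZl//; last exact: integrable_triangle.
  apply: eq_Rintegral => p _.
  transitivity (k ^+ 2 * u p ^+ 2 * dot e e); last by rewrite ee mulr1.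
  by rewrite /G /dot/= /GRing.scale/=; ring.
have D : 2 * k * A = \sum_j dot (side_normal T j) e * side_mean S a c (fun p => u p ^+ 2) j.
  have Eu : (fun p => u p ^+ 2) = expwave (2 * k) e by apply/funext => p; exact: expwave_sqr.
  rewrite -RintegralZl//; last exact: integrable_triangle.
  rewrite Eu -(divergence_triangle a S0 c0 e (c1_smooth (smooth_expwave (2 * k) e))).
  by rewrite derive_expwave ee mulr1; apply: eq_Rintegral => p _; rewrite -expwave_sqr.
rewrite (sum_I3_at _ i) N1 N2 in D; rewrite (sum_I3_at _ i).
set I0 := side_mean _ _ _ _ i in D *; set I1 := side_mean _ _ _ _ (ordS i) in D *.
set I2 := side_mean _ _ _ _ _ in D *.
have ge0 j : 0 <= side_mean S a c (fun p => u p ^+ 2) j.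
  by apply: Rintegral_ge0 => t _; rewrite sqr_ge0.
set N := dot _ e in N3 D.
have l1 := side_length_gt0 a S0 c0 (ordS i).
have X : 0 <= N * I1 by exact: (mulr_ge0 N3 (ge0 _)).
have Y : 0 <= side_length T (ordS i) * I1 by exact: (mulr_ge0 (ltW l1) (ge0 _)).
have kE : alpha = k * s by rewrite /k divfK// gt_eqF.
have kn : k < 0 by rewrite /k pmulr_llt0// invr_gt0.
rewrite -expr_div_n -/k {1}kE.
have Z := mulr_ge0 (ltW s0) Y.
have : k * (2 * k * A) <= k * (- (s * (side_length T i * I0 + side_length T (ordS i) * I1 + side_length T (ord_pred i) * I2))).
  rewrite ler_nM2l// D; lra.
by lra.
Qed.

End UpperBound.

(** * Lower bound for the equilateral triangle *)
Section Comparison.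
Context d {X : measurableType d} {R : realType} (m : {measure set X -> \bar R}).

(** Stated in the extended reals because it also serves to prove that the left side
is finite. *)
Lemma ge0_integral_lincomb_le (D : set X) (F1 F2 F3 : X -> R) (k l : R) :
  measurable D -> measurable_fun D F1 -> measurable_fun D F2 -> measurable_fun D F3 ->
  0 <= k -> 0 <= l -> (forall p, D p -> 0 <= F1 p) -> (forall p, D p -> 0 <= F2 p) ->
  (forall p, D p -> 0 <= F3 p) ->
  (forall p, D p -> F1 p <= k * F2 p + l * F3 p) ->
  (\int[m]_(p in D) (F1 p)%:E <=
   k%:E * \int[m]_(p in D) (F2 p)%:E + l%:E * \int[m]_(p in D) (F3 p)%:E)%E.
Proof.
move=> mD m1 m2 m3 k0 l0 p1 p2 p3 F123.
have e1 := (measurable_EFinP D F1).2 m1.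
have e2 := (measurable_EFinP D F2).2 m2.
have e3 := (measurable_EFinP D F3).2 m3.
rewrite -ge0_integralZl_EFin// -ge0_integralZl_EFin//.
have mk2 : measurable_fun D (fun p => k%:E * (F2 p)%:E)%E by exact: measurable_funeM.
have ml3 : measurable_fun D (fun p => l%:E * (F3 p)%:E)%E by exact: measurable_funeM.
have p2' p : D p -> (0 <= k%:E * (F2 p)%:E)%E.
  by move=> Dp; rewrite mule_ge0 ?lee_fin// p2.
have p3' p : D p -> (0 <= l%:E * (F3 p)%:E)%E.
  by move=> Dp; rewrite mule_ge0 ?lee_fin// p3.
rewrite -ge0_integralD//; apply: ge0_le_integral => //.
exact: emeasurable_funD.
Qed.

End Comparison.

(** Used in place of Minkowski's inequality to pass to the limit in quadratic forms:
the squares of a function and of its approximation differ by a factor close to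
one and by an error controlled by the square of the difference. *)
Lemma young_sqr (R : realType) (dl x y : R) : 0 < dl ->
  x ^+ 2 <= (1 + dl) * y ^+ 2 + (1 + dl^-1) * (y - x) ^+ 2.
Proof.
move=> dl0; rewrite -subr_ge0.
rewrite (_ : _ - _ = dl^-1 * (dl * y + (y - x)) ^+ 2); last by field; rewrite gt_eqF.
by rewrite mulr_ge0 ?sqr_ge0// invr_ge0 ltW.
Qed.

Lemma young_sqrC (R : realType) (dl x y : R) : 0 < dl ->
  x ^+ 2 <= (1 + dl) * y ^+ 2 + (1 + dl^-1) * (x - y) ^+ 2.
Proof. by move=> dl0; rewrite -[(x - y) ^+ 2]sqrrN opprB; exact: young_sqr. Qed.

Lemma cvg0_near_le (R : realType) (f : nat -> \bar R) (e : R) : 0 < e ->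
  f n @[n --> \oo] --> 0%E -> \forall n \near \oo, (f n <= e%:E)%E.
Proof.
move=> e0 /fine_cvgP[ffin /cvgrPdist_lt/(_ e e0)].
apply: filterS2 ffin => n ffin; rewrite sub0r normrN/= => H.
by rewrite -(fineK ffin) lee_fin (le_trans (ler_norm _))// ltW.
Qed.

Section Equilateral.
Context {R : realType}.
Local Notation mu := (@lebesgue_measure R).
Local Notation plane := (measurableTypeR R * measurableTypeR R)%type.
(** c is half the side, r the inradius, and (0, r) the incentre. *)
Variables (S c r : R).
Hypotheses (S0 : 0 < S) (c0 : 0 < c) (r0 : 0 < r).
Hypotheses (Sr : S / c = 3 * r) (cr : c ^+ 2 = 3 * r ^+ 2).
Local Notation T := (triangle S 0 c).
Local Notation Omega := (open_triangle T).

Lemma side_length_equilateral i : side_length T i = 2 * c.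
Proof.
have c20 : 0 <= 2 * c by rewrite mulr_ge0// ltW.
rewrite -[RHS]ger0_norm// -sqrtr_sqr /side_length /norm2; congr Num.sqrt.
by move: i; apply: I3P; rewrite ordS_I3 !triangleE /dot/= ?Sr;
  rewrite exprMn; move: cr; rewrite !expr2; lra.
Qed.

Lemma side_normal_equilateral i (t : R) :
  dot (side_normal T i) (side_point T i t - (0, r)) = 2 * c * r.
Proof.
by move: i; apply: I3P; rewrite /side_normal /side_point ordS_I3 !triangleE /dot/=
  /GRing.scale/= ?Sr; ring.
Qed.

(** The circumradius of an equilateral triangle is twice its inradius. *)
Lemma equilateral_radius (p : R * R) : Omega p ->
  dot (p - (0, r)) (p - (0, r)) <= 4 * r ^+ 2.
Proof.
rewrite open_triangle_chart// /= => Hp; rewrite -[p](unchartK 0 S0 c0).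
case: (unchart S 0 c p) Hp => x y [/= x0 y0 xy].
rewrite /dot /shear/= Sr.
have -> : (- c + (0 + c) * x + 2 * c * y - 0) * (- c + (0 + c) * x + 2 * c * y - 0) =
  3 * r ^+ 2 * (x + 2 * y - 1) ^+ 2 by rewrite -cr; ring.
rewrite -subr_ge0 (_ : _ - _ = 12 * r ^+ 2 * (x * (1 - x - y) + y * (1 - y))); last by ring.
apply: mulr_ge0; first by rewrite mulr_ge0 ?sqr_ge0.
by apply: addr_ge0; apply: mulr_ge0; lra.
Qed.

(** Divergence theorem for f^2 (p - o), where o = (0, r) is the incentre: the field
p - o has divergence 2 and normal component r on each side. *)
Lemma green_radial (f : R * R -> R) : c1 f ->
  r * \sum_i side_length T i * side_mean S 0 c (fun p => f p ^+ 2) i =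
  \int[leb2]_(p in Omega) (2 * f p ^+ 2 + 2 * f p *
    (p.1 * 'D_((1, 0) : R * R) f p + (p.2 - r) * 'D_((0, 1) : R * R) f p)).
Proof.
move=> c1f; have [cf _ cdf] := c1f.
have c1f2 : c1 (fun p => f p ^+ 2) by exact: c1M.
pose f1 (p : R * R) := (dot (1, 0) p + 0) * f p ^+ 2.
pose f2 (p : R * R) := (dot (0, 1) p + (- r)) * f p ^+ 2.
have c11 : c1 f1 := c1M (c1_affine (1, 0) 0) c1f2.
have c12 : c1 f2 := c1M (c1_affine (0, 1) (- r)) c1f2.
have [cf1 _ cdf1] := c11; have [cf2 _ cdf2] := c12.
have Df2 v p : 'D_v (fun q => f q ^+ 2) p = f p * 'D_v f p + f p * 'D_v f p.
  exact: (deriveM_c1 p v c1f c1f).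
have D1 p : 'D_((1, 0) : R * R) f1 p = f p ^+ 2 + p.1 * (2 * f p * 'D_((1, 0) : R * R) f p).
  rewrite (deriveM_c1 p _ (c1_affine (1, 0) 0) c1f2) Df2 derive_affine /dot/=.
  by ring.
have D2 p : 'D_((0, 1) : R * R) f2 p = f p ^+ 2 + (p.2 - r) * (2 * f p * 'D_((0, 1) : R * R) f p).
  rewrite (deriveM_c1 p _ (c1_affine (0, 1) (- r)) c1f2) Df2 derive_affine /dot/=.
  by ring.
transitivity (\int[leb2]_(p in Omega) ('D_((1, 0) : R * R) f1 p + 'D_((0, 1) : R * R) f2 p)); last first.
  by apply: eq_Rintegral => p _; rewrite D1 D2; ring.
have mT := measurable_open_triangle 0 S0 c0.
rewrite RintegralD//; [|exact: integrable_triangle|exact: integrable_triangle].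
rewrite !divergence_triangle// -big_split/= mulr_sumr; apply: eq_bigr => i _.
have cont (h : R * R -> R) (k : R) : continuous h ->
    mu.-integrable `[0, 1] (EFin \o (fun t => k * h (side_point T i t))).
  move=> ch; apply: (@integrable_unit R true false) => t.
  by apply: cvgM; [exact: cvg_cst|exact: continuous_side].
have cont1 (h : R * R -> R) : continuous h ->
    mu.-integrable `[0, 1] (EFin \o (fun t => h (side_point T i t))).
  by move=> ch; apply: (@integrable_unit R true false); exact: continuous_side.
have [cf2' _ _] := c1f2.
rewrite /side_mean mulrA -RintegralZl//; last exact: (cont1 (fun p => f p ^+ 2)).
rewrite -[X in _ = X + _]RintegralZl//; last exact: cont1.
rewrite -[X in _ = _ + X]RintegralZl//; last exact: cont1.
rewrite -RintegralD//; [|exact: cont|exact: cont].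
apply: eq_Rintegral => t _.
rewrite side_length_equilateral [r * _]mulrC -(@side_normal_equilateral i t).
by rewrite /f1 /f2 /dot/=; ring.
Qed.

Variable beta : R.
Hypothesis beta0 : 0 < beta.
Let kappa := 2 * beta / r + 4 * beta ^+ 2.
Notation grad2 f p := ('D_((1, 0) : R * R) f p ^+ 2 + 'D_((0, 1) : R * R) f p ^+ 2).

(** With b = beta / r and d = p - o, the integrand of [green_radial] multiplied by b
is 2 b f^2 + 2 b f d.grad f, and
  2 b f d.grad f <= |grad f|^2 + b^2 |d|^2 f^2 <= |grad f|^2 + 4 beta^2 f^2. *)
Lemma robin_form_c1 (f : R * R -> R) : c1 f ->
  beta * \sum_i side_length T i * side_mean S 0 c (fun p => f p ^+ 2) i <=
  \int[leb2]_(p in Omega) grad2 f p + kappa * \int[leb2]_(p in Omega) (f p ^+ 2).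
Proof.
move=> c1f; have [cf _ cdf] := c1f.
have mT := measurable_open_triangle 0 S0 c0.
have cf2 : continuous (fun p => f p ^+ 2) by move=> p; apply: cvgM; exact: cf.
have cg : continuous (fun p => grad2 f p).
  by move=> p; apply: cvgD; apply: cvgM; exact: cdf.
have crad : continuous (fun p => 2 * f p ^+ 2 + 2 * f p *
    (p.1 * 'D_((1, 0) : R * R) f p + (p.2 - r) * 'D_((0, 1) : R * R) f p)).
  move=> p; apply: cvgD; first by apply: cvgM; [exact: cvg_cst|exact: cf2].
  apply: cvgM; first by apply: cvgM; [exact: cvg_cst|exact: cf].
  apply: cvgD; apply: cvgM; try exact: cdf; first exact: cvg_fst.
  by apply: cvgB; [exact: cvg_snd|exact: cvg_cst].
have If2 := integrable_triangle 0 S0 c0 cf2.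
set B := \sum_i _; rewrite (_ : beta * B = beta / r * (r * B)); last first.
  by field; rewrite gt_eqF.
rewrite /B green_radial//.
rewrite -RintegralZl//; last exact: integrable_triangle.
rewrite -(RintegralZl kappa mT If2) -RintegralD//; last 2 first.
- exact: integrable_triangle.
- exact: (integrableZl mT kappa If2).
apply: le_Rintegral => //.
- apply: integrable_triangle => // p; apply: cvgM; [exact: cvg_cst|exact: crad].
- apply: integrable_triangle => // p; apply: cvgD; [exact: cg|].
  by apply: cvgM; [exact: cvg_cst|exact: cf2].
move=> p /equilateral_radius; rewrite /dot/= subr0.
set gx := 'D_ _ _ _; set gy := 'D_ _ _ _; set x := p.1; set y := p.2 - r; set w := f p.
move=> Hr; pose b := beta / r.
have b0 : 0 < b by rewrite divr_gt0.
have Hb : b ^+ 2 * w ^+ 2 * (x * x + y * y) <= b ^+ 2 * w ^+ 2 * (4 * r ^+ 2).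
  by rewrite ler_wpM2l// mulr_ge0 ?sqr_ge0.
have Q1 := sqr_ge0 (gx - b * w * x); have Q2 := sqr_ge0 (gy - b * w * y).
rewrite -/b; have -> : kappa = 2 * b + 4 * (b ^+ 2 * r ^+ 2).
  by rewrite /kappa /b; field; rewrite gt_eqF.
by move: Hb Q1 Q2; rewrite !expr2; lra.
Qed.

Lemma boundary_lincomb_le (U : 'I_3 -> R * R) (F1 F2 F3 : R * R -> R) (k l : R) :
  (forall i, measurable_fun (`[0, 1] : set (measurableTypeR R)) (fun t => F1 (side_point U i t))) ->
  (forall i, measurable_fun (`[0, 1] : set (measurableTypeR R)) (fun t => F2 (side_point U i t))) ->
  (forall i, measurable_fun (`[0, 1] : set (measurableTypeR R)) (fun t => F3 (side_point U i t))) ->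
  0 <= k -> 0 <= l -> (forall p, 0 <= F1 p) -> (forall p, 0 <= F2 p) ->
  (forall p, 0 <= F3 p) -> (forall p, F1 p <= k * F2 p + l * F3 p) ->
  (boundary_integral U F1 <= k%:E * boundary_integral U F2 + l%:E * boundary_integral U F3)%E.
Proof.
move=> m1 m2 m3 k0 l0 p1 p2 p3 F123; rewrite /boundary_integral.
have L0 i : (0 <= (side_length U i)%:E)%E by rewrite lee_fin norm2_ge0.
have I0 (F : R * R -> R) i : (forall p, 0 <= F p) ->
    (0 <= \int[mu]_(t in `[0%R, 1%R]) (F (side_point U i t))%:E)%E.
  by move=> F0; apply: integral_ge0 => t _; rewrite lee_fin.
rewrite ge0_sume_distrr; last by move=> i _; rewrite mule_ge0 ?I0.
rewrite ge0_sume_distrr; last by move=> i _; rewrite mule_ge0 ?I0.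
rewrite -big_split/=; apply: lee_sum => i _.
rewrite !muleA [(k%:E * _)%E]muleC [(l%:E * _)%E]muleC -!muleA -ge0_muleDr; last 2 first.
- by rewrite mule_ge0 ?lee_fin ?I0.
- by rewrite mule_ge0 ?lee_fin ?I0.
by apply: lee_wpmul2l => //; apply: ge0_integral_lincomb_le.
Qed.

(** [robin_form_c1] holds for the functions that approximate u, and the three
integrals of u, of its gradient and of its trace are reached in the limit. *)
Lemma robin_form_trace (u : R * R -> R) (G : R * R -> R * R) (g : R * R -> R) :
  H1_with_gradient Omega u G -> is_trace T u G g ->
  beta * fine (boundary_integral T (fun p => g p ^+ 2)) <=
  \int[leb2]_(p in Omega) dot (G p) (G p) + kappa * \int[leb2]_(p in Omega) (u p ^+ 2).
Proof.
move=> [[mu_ Uoo] [mG1 G1oo] [mG2 G2oo] _] [[mg Boo] [phi [sphi cu cG cg]]].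
have mT := measurable_open_triangle 0 S0 c0.
have r0' := r0; have kappa0 : 0 <= kappa.
  by rewrite addr_ge0 ?mulr_ge0 ?sqr_ge0 ?invr_ge0// ltW.
have U0 : (0 <= \int[leb2]_(p in Omega) (u p ^+ 2)%:E)%E.
  by apply: integral_ge0 => p _; rewrite lee_fin sqr_ge0.
have B0 : (0 <= boundary_integral T (fun p => (g p ^+ 2)%R))%E.
  apply: sume_ge0 => i _; rewrite mule_ge0 ?lee_fin ?norm2_ge0//.
  by apply: integral_ge0 => p _; rewrite lee_fin sqr_ge0.
have mGG : measurable_fun (Omega : set plane) (fun p => dot (G p) (G p)).
  by apply: measurable_funD; apply: measurable_funM.
have GG0 p : 0 <= dot (G p) (G p) by exact: dot_ge0.
have Goo : (\int[leb2]_(p in Omega) (dot (G p) (G p))%:E < +oo)%E.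
  have := @ge0_integral_lincomb_le _ _ _ leb2 Omega (fun p => dot (G p) (G p))
    (fun p => (G p).1 ^+ 2) (fun p => (G p).2 ^+ 2) 1 1 mT mGG.
  move=> H; apply: (le_lt_trans (H _ _ _ _ _ _ _ _)) => //.
  - exact: measurable_funX.
  - exact: measurable_funX.
  - by move=> p _; rewrite sqr_ge0.
  - by move=> p _; rewrite sqr_ge0.
  - by move=> p _; rewrite !mul1r /dot -!expr2.
  - by rewrite !mul1e lte_add_pinfty.
have UE : (\int[leb2]_(p in Omega) (u p ^+ 2)%:E =
   (\int[leb2]_(p in Omega) (u p ^+ 2))%R%:E)%E.
  by rewrite /Rintegral fineK// ge0_fin_numE.
have GE : (\int[leb2]_(p in Omega) (dot (G p) (G p))%:E =
   (\int[leb2]_(p in Omega) (dot (G p) (G p)))%R%:E)%E.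
  rewrite /Rintegral fineK// ge0_fin_numE//.
  by apply: integral_ge0 => p _; rewrite lee_fin.
have BE : boundary_integral T (fun p => (g p ^+ 2)%R) =
    (fine (boundary_integral T (fun p => (g p ^+ 2)%R)))%:E.
  by rewrite fineK// ge0_fin_numE.
set B := fine (boundary_integral _ _) in BE *.
set Gam := \int[leb2]_(p in Omega) dot (G p) (G p) in GE *.
set U := \int[leb2]_(p in Omega) (u p ^+ 2) in UE *.
have Gam0 : 0 <= Gam by apply: Rintegral_ge0.
have U0' : 0 <= U by apply: Rintegral_ge0 => p _; rewrite sqr_ge0.
pose X := Gam + kappa * U.
have X0 : 0 <= X by rewrite addr_ge0// mulr_ge0.
(* dl is both the parameter of Young's inequality and the order of the approximation: the
   factor 1 / dl is absorbed by errors of size dl ^+ 2 *)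
have main dl : 0 < dl -> dl <= 1 ->
    beta * B <= X + dl * (3 * X + 4 * (1 + kappa) + 2 * beta).
  move=> dl0 dl1.
  have dl2 : 0 < dl ^+ 2 by rewrite exprn_gt0.
  have [n [nu nG nb]] : exists n, [/\
     (\int[leb2]_(p in Omega) ((phi n p - u p) ^+ 2)%:E <= (dl ^+ 2)%:E)%E,
     (\int[leb2]_(p in Omega)
           (('D_((1, 0) : R * R) (phi n) p - (G p).1) ^+ 2 +
            ('D_((0, 1) : R * R) (phi n) p - (G p).2) ^+ 2)%:E <= (dl ^+ 2)%:E)%E &
     (boundary_integral T (fun p => (phi n p - g p) ^+ 2)%R <= (dl ^+ 2)%:E)%E].
    have H1 := cvg0_near_le dl2 cu; have H2 := cvg0_near_le dl2 cG.
    have H3 := cvg0_near_le dl2 cg.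
    near \oo => n; exists n; split; near: n; [exact: H1|exact: H2|exact: H3].
  have c1p := c1_smooth (sphi n); have [cp _ cdp] := c1p.
  have k0 : 0 <= 1 + dl by lra.
  have l0 : 0 <= 1 + dl^-1 by rewrite addr_ge0// invr_ge0 ltW.
  have ldl : (1 + dl^-1) * dl ^+ 2 <= 2 * dl.
    have -> : (1 + dl^-1) * dl ^+ 2 = dl * dl + dl by field; rewrite gt_eqF.
    by have := ler_wpM2l (ltW dl0) dl1; lra.
  have mp : measurable_fun (Omega : set plane) (phi n) by exact: continuous_plane_measurable.
  have mdp v : measurable_fun (Omega : set plane) ('D_v (phi n)).
    exact: continuous_plane_measurable.
  have cp2 : continuous (fun p => phi n p ^+ 2) by move=> p; apply: cvgM; exact: cp.
  have absorb (x : R) (y : \bar R) : (y <= (dl ^+ 2)%:E)%E ->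
      ((1 + dl)%:E * x%:E + (1 + dl^-1)%:E * y <= ((1 + dl) * x + 2 * dl)%:E)%E.
    move=> ydl; rewrite [leRHS]EFinD [X in (_ <= X + _)%E]EFinM leeD2l//.
    apply: le_trans (lee_wpmul2l _ ydl) _; first by rewrite lee_fin.
    by rewrite -EFinM lee_fin.
  have Un : \int[leb2]_(p in Omega) (phi n p ^+ 2) <= (1 + dl) * U + 2 * dl.
    rewrite -lee_fin /Rintegral fineK; last first.
      exact: (integrable_fin_num mT (integrable_triangle 0 S0 c0 cp2)).
    apply: le_trans (absorb U _ nu); rewrite -UE.
    apply: ge0_integral_lincomb_le => //; try by move=> p _; rewrite sqr_ge0.
    - exact: measurable_funX.
    - exact: measurable_funX.
    - by apply: measurable_funX; exact: measurable_funB.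
    - by move=> p _; exact: young_sqrC.
  have Gn : \int[leb2]_(p in Omega) grad2 (phi n) p <= (1 + dl) * Gam + 2 * dl.
    rewrite -lee_fin /Rintegral fineK; last first.
      apply: (integrable_fin_num mT); apply: integrable_triangle => // p.
      by apply: cvgD; apply: cvgM; exact: cdp.
    apply: le_trans (absorb Gam _ nG); rewrite -GE.
    apply: ge0_integral_lincomb_le => //; try by move=> p _; rewrite addr_ge0 ?sqr_ge0.
    - by apply: measurable_funD; exact: measurable_funX.
    - by apply: measurable_funD; apply: measurable_funX; exact: measurable_funB.
    - move=> p _; rewrite /dot -!expr2.
      have Y1 := @young_sqrC R dl ('D_((1, 0) : R * R) (phi n) p) (G p).1 dl0.
      have Y2 := @young_sqrC R dl ('D_((0, 1) : R * R) (phi n) p) (G p).2 dl0.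
      by rewrite [(1 + dl) * _]mulrDr [(1 + dl^-1) * _]mulrDr addrACA; exact: (lerD Y1 Y2).
  have Bn : B <= (1 + dl) * (\sum_i side_length T i * side_mean S 0 c (fun p => phi n p ^+ 2) i) + 2 * dl.
    rewrite -lee_fin -BE; apply: le_trans (absorb _ _ nb).
    rewrite -boundary_integral_continuous//.
    have ms i : measurable_fun (`[0, 1] : set (measurableTypeR R))
        (fun t => phi n (side_point T i t)).
      apply: (measurable_funS measurableT) => //.
      by apply: continuous_measurable_fun; exact: continuous_side.
    apply: boundary_lincomb_le => //; try by move=> p; rewrite sqr_ge0.
    - by move=> i; exact: measurable_funX.
    - by move=> i; exact: measurable_funX.
    - by move=> i; apply: measurable_funX; exact: measurable_funB.
    - by move=> p; exact: young_sqr.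
  have Rn := robin_form_c1 c1p.
  set Bp := \sum_i _ in Bn Rn; set Gp := \int[leb2]_(p in _) _ in Gn Rn.
  set Up := \int[leb2]_(p in _) _ in Un Rn.
  have h1 : beta * B <= (1 + dl) * (beta * Bp) + 2 * dl * beta.
    rewrite (_ : _ + _ = beta * ((1 + dl) * Bp + 2 * dl)); last by ring.
    by rewrite ler_wpM2l// ltW.
  have h2 : Gp + kappa * Up <= (1 + dl) * X + 2 * dl * (1 + kappa).
    have := ler_wpM2l kappa0 Un; rewrite /X; lra.
  have h3 : (1 + dl) * (beta * Bp) <= (1 + dl) * ((1 + dl) * X + 2 * dl * (1 + kappa)).
    by rewrite ler_wpM2l// (le_trans Rn).
  have h4 : dl * dl * X <= dl * X by rewrite -mulrA ler_piMl// mulr_ge0// ltW.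
  have h5 : dl * (dl * (1 + kappa)) <= dl * (1 + kappa).
    have k1 : 0 <= 1 + kappa by rewrite addr_ge0.
    by rewrite ler_piMl// mulr_ge0// ltW.
  by lra.
apply/ler_addgt0Pr => e e0.
pose K := 3 * X + 4 * (1 + kappa) + 2 * beta.
have K0 : 0 < K by rewrite /K; have := beta0; lra.
pose dl := Num.min 1 (e / K).
have dl0 : 0 < dl by rewrite lt_min ltr01 divr_gt0.
have dl1 : dl <= 1 by rewrite ge_min lexx.
apply: (le_trans (main dl dl0 dl1)); rewrite lerD2l -/K -ler_pdivlMr//.
by rewrite ge_min lexx orbT.
Unshelve. all: end_near. Qed.

Lemma robin_eigenvalue_equilateral_ge :
  ((- (2 * beta / r + 4 * beta ^+ 2))%:E <= robin_eigenvalue (- beta) T)%E.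
Proof.
apply/ereal_infP => _ [u [G [g [H1 tr Nu ->]]]]; rewrite lee_fin /robin_quotient.
have mT := measurable_open_triangle 0 S0 c0.
have [[mu_ Uoo] _ _ _] := H1.
have U0 := sqr_integral_gt0 mT mu_ Nu.
have UR0 : 0 < \int[leb2]_(p in Omega) (u p ^+ 2).
  by rewrite -lte_fin /Rintegral fineK// ge0_fin_numE// ltW.
rewrite ler_pdivlMr//; have := robin_form_trace H1 tr; rewrite /kappa; lra.
Qed.

End Equilateral.

(** * The smallest angle and its adjacent sides *)
Section SharpestAngle.
Context {R : realType}.
Variables (S a c : R).
Hypotheses (S0 : 0 < S) (c0 : 0 < c).
Local Notation T := (triangle S a c).
Local Notation side := (side_length T).

Lemma angle_bounds i : 0 < angle T i < pi.
Proof. exact: vector_angle_bounds (cross_triangle_gt0 a S0 c0 i). Qed.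

Lemma law_of_cosines i : 2 * (side i * side (ord_pred i)) * cos (angle T i) =
  side i ^+ 2 + side (ord_pred i) ^+ 2 - side (ordS i) ^+ 2.
Proof.
have vw := cross_triangle_gt0 a S0 c0 i.
rewrite side_length_pred /side_length ordSS3.
set v := T (ordS i) - T i in vw *; set w := T (ord_pred i) - T i in vw *.
rewrite (cos_vector_angle vw) -/v -/w.
rewrite (_ : T (ord_pred i) - T (ordS i) = w - v); last first.
  by rewrite /w /v opprB addrA subrK.
rewrite !sqr_norm2; transitivity (2 * dot v w); last by rewrite /dot/=; ring.
by field; rewrite (gt_eqF (norm2_gt0l vw)) (gt_eqF (norm2_gt0r vw)).
Qed.

Lemma area_sides i : side i * side (ord_pred i) * sin (angle T i) = 2 * S.
Proof.
have vw := cross_triangle_gt0 a S0 c0 i.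
rewrite side_length_pred (sin_vector_angle vw) cross_triangle// mulrC divfK//.
by rewrite mulf_neq0 ?gt_eqF ?(norm2_gt0l vw) ?(norm2_gt0r vw).
Qed.

Lemma cos_angle_le j : cos (angle T j) <= cos (smallest_angle T).
Proof.
rewrite /smallest_angle /sharpest_vertex; case: arg_minP => // i _ /(_ j isT) ij.
have /andP[i1 i2] := angle_bounds i; have /andP[j1 j2] := angle_bounds j.
by rewrite leNgt ltr_cos ?in_itv/= ?ltW// -leNgt.
Qed.

(** If the cosine of the smallest angle were at most 1 / 2, so would be the other
two cosines. The laws of cosines for side lengths x, y, z then add up to
x^2 + y^2 + z^2 <= x y + y z + z x, which forces x = y = z. *)
Lemma half_lt_cos_smallest_angle : ~ equilateral T -> 1 / 2 < cos (smallest_angle T).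
Proof.
move=> neq; rewrite ltNge; apply/negP => C; apply: neq.
have bound i : side i ^+ 2 + side (ord_pred i) ^+ 2 - side (ordS i) ^+ 2 <=
    side i * side (ord_pred i).
  rewrite -law_of_cosines; have := le_trans (cos_angle_le i) C.
  have xy : 0 <= side i * side (ord_pred i) by rewrite mulr_ge0 ?norm2_ge0.
  by move=> /(ler_wpM2l xy); lra.
have := bound i0; have := bound i1; have := bound i2; rewrite !ordS_I3 !ord_pred_I3.
set x := side i0; set y := side i1; set z := side i2 => h1 h2 h3.
have s : (x - y) ^+ 2 + (y - z) ^+ 2 + (z - x) ^+ 2 <= 0.
  by move: h1 h2 h3; rewrite !expr2; lra.
have [xy yz] : x = y /\ y = z.
  have p1 := sqr_ge0 (x - y); have p2 := sqr_ge0 (y - z); have p3 := sqr_ge0 (z - x).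
  split; apply/eqP; rewrite -subr_eq0 -sqrf_eq0; apply/eqP; lra.
by apply: I3P => //; apply: I3P; rewrite -/x -/y -/z ?xy ?yz.
Qed.

(** The larger angle faces the larger side. Here C and D are the cosines of the
angles facing z and y. Eliminating them leaves
(z - y) ((y + z)^2 - x^2) <= 0, where the second factor is positive by the
triangle inequality. *)
Lemma opposite_side_le (x y z C D : R) : 0 < x -> 0 < y -> 0 < z -> C < 1 ->
  2 * (x * y) * C = x ^+ 2 + y ^+ 2 - z ^+ 2 ->
  2 * (x * z) * D = x ^+ 2 + z ^+ 2 - y ^+ 2 -> D <= C -> z <= y.
Proof.
move=> x0 y0 z0 C1 EC ED DC; rewrite leNgt; apply/negP => yz.
have xy0 : 0 < x * y by rewrite mulr_gt0.
have xyz : x < y + z.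
  rewrite ltNge; apply/negP => yzx.
  have h1 : x * y * C < x * y by rewrite gtr_pMr.
  have h2 : z * z <= (x - y) * (x - y) by apply: ler_pM; lra.
  by move: EC; rewrite !expr2; lra.
have h : z * y * (x * D) <= z * y * (x * C).
  by rewrite ler_wpM2l ?ler_wpM2l// ?mulr_ge0// ltW.
have h3 : 0 < (z - y) * ((y + z - x) * (y + z + x)) by rewrite !mulr_gt0//; lra.
have e1 : 2 * (z * y * (x * C)) = z * (x ^+ 2 + y ^+ 2 - z ^+ 2) by rewrite -EC; ring.
have e2 : 2 * (z * y * (x * D)) = y * (x ^+ 2 + z ^+ 2 - y ^+ 2) by rewrite -ED; ring.
by move: h3 e1 e2 h; rewrite !expr2; lra.
Qed.

(** Let x and y be the sides adjacent to the smallest angle and z the opposite one.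
Then z <= x and z <= y, so x and y differ at most by a factor 2, whereas
x y >= x y sin theta = 2 S. *)
Lemma shorter_adjacent_side_ge : S <= shorter_adjacent_side T ^+ 2.
Proof.
rewrite /shorter_adjacent_side; set i := sharpest_vertex T.
have Ci j : cos (angle T j) <= cos (angle T i) by exact: cos_angle_le.
have Li := law_of_cosines i.
have Ls := law_of_cosines (ordS i); have Lp := law_of_cosines (ord_pred i).
have A := area_sides i.
have x0 := side_length_gt0 a S0 c0 i; have y0 := side_length_gt0 a S0 c0 (ord_pred i).
have z0 := side_length_gt0 a S0 c0 (ordS i).
have Cs := Ci (ordS i); have Cp := Ci (ord_pred i).
have predS : ord_pred (ordS i) = i.
  by move: i {Ci Li Ls Lp A x0 y0 z0 Cs Cp}; apply: I3P; rewrite !ordS_I3 ?ord_pred_I3.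
have predpred : ord_pred (ord_pred i) = ordS i.
  by move: i {Ci Li Ls Lp A x0 y0 z0 Cs Cp predS}; apply: I3P; rewrite !ord_pred_I3 ?ordS_I3.
rewrite ordSS3 predS in Ls; rewrite ordSK3 predpred in Lp.
have C1 : cos (angle T i) < 1.
  have [s1 _ -> _] := half_angle (angle_bounds i).
  have := exprn_gt0 2 s1; lra.
set x := side i in x0 Li Ls Lp A *; set y := side (ord_pred i) in y0 Li Ls Lp A *.
set z := side (ordS i) in z0 Li Ls Lp.
have zy : z <= y by apply: (opposite_side_le x0 y0 z0 C1 Li _ Cs); rewrite [x * z]mulrC Ls; ring.
have zx : z <= x.
  apply: (opposite_side_le y0 x0 z0 C1 _ _ Cp); first by rewrite [y * x]mulrC Li; ring.
  exact: Lp.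
have xy0 : 0 < x * y by rewrite mulr_gt0.
have C0 : x * y * cos (angle T i) <= x * y by rewrite ler_piMr// ltW.
have xyz : (x - y) * (x - y) <= z * z by move: Li; rewrite !expr2; lra.
have xyS : 2 * S <= x * y.
  by rewrite -A ler_piMr ?sin_le1// ltW.
have y2x : y <= 2 * x.
  rewrite leNgt; apply/negP => h.
  have : z * z < (y - x) * (y - x) by apply: ltr_pM; lra.
  by lra.
have x2y : x <= 2 * y.
  rewrite leNgt; apply/negP => h.
  have : z * z < (x - y) * (x - y) by apply: ltr_pM; lra.
  by lra.
have h1 : x * y <= x * (2 * x) by rewrite ler_wpM2l// ltW.
have h2 : x * y <= 2 * y * y by rewrite ler_wpM2r// ltW.
by rewrite /Num.min; case: ifP => _; rewrite expr2; lra.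
Qed.

Lemma shorter_adjacent_side_gt0 : 0 < shorter_adjacent_side T.
Proof. by rewrite lt_min !side_length_gt0. Qed.

End SharpestAngle.

(** * Validity of the star condition *)

Lemma expRN_le (R : realType) (t : R) : 0 < t -> expR (- t) <= t^-1.
Proof.
move=> t0; rewrite expRN lef_pV2 ?posrE ?expR_gt0//.
by rewrite (le_trans _ (expR_ge1Dx t))// lerDr.
Qed.

Section StarCondition.
Context {R : realType}.
Variables (S a c : R).
Hypotheses (S0 : 0 < S) (c0 : 0 < c).
Local Notation T := (triangle S a c).
Local Notation s := (sin (smallest_angle T / 2)).
Local Notation k := (cos (smallest_angle T / 2)).
Local Notation height := (Num.sqrt (Num.sqrt 3 * S)).

Lemma equilateral_height_gt0 : 0 < height.
Proof. by rewrite sqrtr_gt0 mulr_gt0// sqrtr_gt0. Qed.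

Lemma sqr_equilateral_height : Num.sqrt 3 * S = height ^+ 2.
Proof. by rewrite sqr_sqrtr// mulr_ge0 ?sqrtr_ge0// ltW. Qed.

Lemma half_smallest_angle : [/\ 0 < s, 0 < k,
  cos (smallest_angle T) = 1 - 2 * s ^+ 2 & k ^+ 2 = 1 - s ^+ 2].
Proof.
have [? ? ? _] := half_angle (angle_bounds a S0 c0 (sharpest_vertex T)).
by split => //; exact: cos2sin2.
Qed.

(** The condition in terms of beta > 0 and of the height of the equilateral triangle
of area S. *)
Lemma star_conditionP (alpha : R) (beta := - alpha)
    (E := expR (- (2 * beta * shorter_adjacent_side T * (k / s)))) :
  4 * beta ^+ 2 + 24 * beta / height + 36 / height ^+ 2 <= beta ^+ 2 / s ^+ 2 * (1 - 2 * E) ->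
  star_condition S a c alpha.
Proof.
rewrite /E /beta sqrrN => H; rewrite /star_condition /cot.
have PE := sqr_equilateral_height; set p := height in H PE *; rewrite PE.
have -> : 2 * alpha * shorter_adjacent_side T * (k / s) =
  - (2 * - alpha * shorter_adjacent_side T * (k / s)) by ring.
have -> : 24 * alpha / p = - (24 * (- alpha) / p) by ring.
by lra.
Qed.

(** As sin^2 (theta / 2) < 1 / 4, the difference of the quadratic coefficients,
K - 4 below, is positive. The bound exp (- t) <= 1 / t makes the exponential
correction linear in beta, like the other terms. *)
Lemma star_condition_large : ~ equilateral T ->
  exists alpha_star : R, alpha_star < 0 /\
    forall alpha : R, alpha <= alpha_star -> star_condition S a c alpha.
Proof.
move=> /(half_lt_cos_smallest_angle S0 c0) C; have [s0 k0 Cs _] := half_smallest_angle.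
have height0 := equilateral_height_gt0.
have M0 : 0 < shorter_adjacent_side T * (k / s).
  by rewrite mulr_gt0 ?divr_gt0// shorter_adjacent_side_gt0.
set M := _ * _ in M0.
pose K := (s ^+ 2)^-1.
have K4 : 4 < K.
  rewrite /K -[4]invrK ltf_pV2 ?posrE ?invr_gt0 ?exprn_gt0//.
  lra.
pose Q := 24 / height + 36 / height ^+ 2 + K / M.
have Q0 : 0 < Q by rewrite !addr_gt0 ?divr_gt0 ?exprn_gt0//; lra.
have KQ0 : 0 < Q / (K - 4) by rewrite divr_gt0// subr_gt0.
exists (- (1 + Q / (K - 4))); split; first lra.
move=> alpha ha; apply: star_conditionP.
rewrite -!mulrA -/M; set beta := - alpha.
have b1 : 1 + Q / (K - 4) <= beta by rewrite /beta; lra.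
have b0 : 0 < beta by lra.
have EM : expR (- (2 * (beta * M))) <= (2 * (beta * M))^-1.
  by apply: expRN_le; apply: mulr_gt0 => //; exact: (mulr_gt0 b0 M0).
set E := expR _ in EM *.
have h1 : beta * beta * K * 2 * E <= beta * (K / M).
  have -> : beta * (K / M) = beta * beta * K * 2 * (2 * (beta * M))^-1.
    by field; rewrite !gt_eqF.
  by rewrite ler_wpM2l// !mulr_ge0//; lra.
have h2 : 36 / height ^+ 2 <= beta * (36 / height ^+ 2).
  by rewrite ler_peMl ?divr_ge0 ?sqr_ge0//; lra.
have h3 : beta * Q <= beta * (beta * (K - 4)).
  by rewrite ler_wpM2l ?(ltW b0)// -ler_pdivrMr ?subr_gt0//; lra.
rewrite -/K !expr2; move: h1 h2 h3; rewrite /Q !expr2; lra.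
Qed.

(** The first two bounds on the sine make the exponential at most 1 / 4, so the right
side is at least beta^2 / (2 sin^2 (theta / 2)); the third bound compares this
with the left side. *)
Lemma star_condition_sharp (alpha : R) (beta := - alpha) : 0 < beta ->
  s <= 1 / 2 -> s <= beta * Num.sqrt S / 3 ->
  2 * (4 * beta ^+ 2 + 24 * beta / height + 36 / height ^+ 2) * s ^+ 2 <= beta ^+ 2 ->
  star_condition S a c alpha.
Proof.
move=> b0 s1 s2 s3; have [s0 k0 _ ks] := half_smallest_angle.
apply: star_conditionP; rewrite -/beta.
set W := _ + _ in s3 *; set L := shorter_adjacent_side T.
have L0 : 0 < L by exact: shorter_adjacent_side_gt0.
have LS : Num.sqrt S <= L.
  by rewrite -[L]ger0_norm ?(ltW L0)// -sqrtr_sqr ler_wsqrtr// shorter_adjacent_side_ge.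
have k2 : 1 / 2 <= k.
  rewrite leNgt; apply/negP => kk.
  have : k * k < 1 / 2 * (1 / 2) by apply: ltr_pM => //; exact: ltW.
  have : s * s <= 1 / 2 * (1 / 2) by apply: ler_pM => //; exact: ltW.
  by move: ks; rewrite !expr2; lra.
have t3 : 3 <= 2 * beta * L * (k / s).
  rewrite mulrA ler_pdivlMr//.
  have h1 : beta * Num.sqrt S <= beta * L by rewrite ler_wpM2l// ltW.
  have h2 : 2 * beta * L * (1 / 2) <= 2 * beta * L * k.
    by rewrite ler_wpM2l// !mulr_ge0// ltW.
  lra.
have E4 : expR (- (2 * beta * L * (k / s))) <= 1 / 4.
  rewrite expRN div1r lef_pV2 ?posrE ?expR_gt0//.
  by rewrite (le_trans _ (expR_ge1Dx _))//; lra.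
set E := expR _ in E4 *.
have : W <= beta ^+ 2 / s ^+ 2 * (1 / 2).
  rewrite -mulrA [_^-1 * _]mulrC mulrA ler_pdivlMr ?exprn_gt0//; lra.
have : 0 <= beta ^+ 2 / s ^+ 2 by rewrite divr_ge0 ?sqr_ge0.
move=> X0 /le_trans; apply; rewrite ler_wpM2l//; lra.
Qed.

End StarCondition.

Lemma sin_half_small (R : realType) (e : R) : 0 < e ->
  exists theta0 : R, 0 < theta0 /\
    forall x : R, 0 < x -> x < theta0 -> sin (x / 2) < e.
Proof.
move=> e0; have /cvgrPdist_lt/(_ e e0) := @continuous_sin R 0.
rewrite sin0 => /nbhs_ballP[d /= d0 Hd]; exists d; split => // x x0 xd.
have : ball 0 d (x / 2) by rewrite /ball/= sub0r normrN ger0_norm; lra.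
by move=> /Hd/=; rewrite sub0r normrN => /(le_lt_trans (ler_norm _)).
Qed.

Lemma star_condition_small_angle (R : realType) (S alpha : R) : 0 < S -> alpha < 0 ->
  exists theta0 : R, 0 < theta0 /\
    forall a c : R, 0 < c -> smallest_angle (triangle S a c) < theta0 ->
      star_condition S a c alpha.
Proof.
move=> S0 alpha0; have b0 : 0 < - alpha by rewrite oppr_gt0.
have P0 := equilateral_height_gt0 S0; set P := Num.sqrt _ in P0.
pose W := 2 * (4 * (- alpha) ^+ 2 + 24 * (- alpha) / P + 36 / P ^+ 2).
have W0 : 0 < W.
  by rewrite mulr_gt0// !addr_gt0 ?divr_gt0 ?mulr_gt0 ?exprn_gt0.
pose e := Num.min (1 / 2) (Num.min (- alpha * Num.sqrt S / 3) ((- alpha) / Num.sqrt W)).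
have e0 : 0 < e.
  by rewrite !lt_min !divr_gt0 ?mulr_gt0 ?sqrtr_gt0.
have [theta0 [t0 H]] := sin_half_small e0.
exists theta0; split => // a c c0 /H sE.
have [s0 _ _ _] := half_smallest_angle a S0 c0.
have /andP[a0 _] := angle_bounds a S0 c0 (sharpest_vertex (triangle S a c)).
have {sE} := sE a0; rewrite !lt_min => /and3P[e1 e2 e3].
apply: star_condition_sharp => //; [exact: ltW|exact: ltW|].
rewrite -/P -/W -(sqr_sqrtr (ltW W0)) -exprMn.
rewrite lerXn2r ?nnegrE ?mulr_ge0 ?sqrtr_ge0 ?(ltW s0) ?(ltW b0)//.
by rewrite mulrC -ler_pdivlMr ?sqrtr_gt0// ltW.
Qed.

(** The inradius is a third of the height, and in terms of the inradius r the two
bounds differ by 6 beta / r + 4 / r^2. *)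
Lemma robin_eigenvalue_equilateral_gt (R : realType) (S alpha : R) :
  0 < S -> alpha < 0 ->
  ((- 4 * alpha ^+ 2 + 24 * alpha / Num.sqrt (Num.sqrt 3 * S)
    - 36 / (Num.sqrt 3 * S))%:E < robin_eigenvalue alpha (equilateral_triangle S))%E.
Proof.
move=> S0 alpha0; have b0 : 0 < - alpha by rewrite oppr_gt0.
have P0 := equilateral_height_gt0 S0; have PE := sqr_equilateral_height S0.
set P := Num.sqrt (_ * S) in P0 PE *; rewrite PE /equilateral_triangle.
have q0 : 0 < Num.sqrt 3 :> R by rewrite sqrtr_gt0.
have q2 : Num.sqrt 3 ^+ 2 = 3 :> R by rewrite sqr_sqrtr.
set q := Num.sqrt 3 in q0 q2 PE *.
have Sq0 : 0 < S / q by rewrite divr_gt0.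
have c0 : 0 < Num.sqrt (S / q) by rewrite sqrtr_gt0.
have c2 : Num.sqrt (S / q) ^+ 2 = S / q by rewrite sqr_sqrtr// ltW.
set c := Num.sqrt _ in c0 c2 *.
have r0 : 0 < P / 3 by rewrite divr_gt0.
have cr : c ^+ 2 = 3 * (P / 3) ^+ 2.
  by rewrite c2 exprMn -PE -q2; field; rewrite gt_eqF.
have Sr : S / c = 3 * (P / 3).
  have -> : S / c = q * c by rewrite -[S](@divfK _ q) ?gt_eqF// -c2; field; rewrite gt_eqF.
  have -> : 3 * (P / 3) = P by field.
  have qc0 : 0 <= q * c by rewrite mulr_ge0// ltW.
  apply/eqP; rewrite -(eqrXn2 (n := 2)) ?(ltW P0)// exprMn q2 c2 -PE -q2.
  by apply/eqP; field; rewrite gt_eqF.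
rewrite -[in ltRHS](opprK alpha).
apply: lt_le_trans (robin_eigenvalue_equilateral_ge S0 c0 r0 Sr cr b0).
have x0 : 0 < - alpha / P by rewrite divr_gt0.
have y0 : 0 < 36 / P ^+ 2 by rewrite divr_gt0// exprn_gt0.
rewrite lte_fin sqrrN (_ : 2 * - alpha / (P / 3) = 6 * (- alpha / P)); last first.
  by field; rewrite gt_eqF.
rewrite (_ : 24 * alpha / P = - 24 * (- alpha / P)); last by ring.
lra.
Qed.

Theorem theorem5p3 (R : realType) (S : R) (S_gt0 : 0 < S) :
  (forall a c alpha : R,
     0 < c -> ~ equilateral (triangle S a c) -> alpha < 0 ->
     star_condition S a c alpha ->
     (robin_eigenvalue alpha (triangle S a c)
        < robin_eigenvalue alpha (equilateral_triangle S))%E) /\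
  (forall a c : R,
     0 < c -> ~ equilateral (triangle S a c) ->
     exists alpha_star : R, alpha_star < 0 /\
       forall alpha : R, alpha <= alpha_star -> star_condition S a c alpha) /\
  (forall alpha : R, alpha < 0 ->
     exists theta0 : R, 0 < theta0 /\
       forall a c : R, 0 < c ->
         smallest_angle (triangle S a c) < theta0 ->
         star_condition S a c alpha).
Proof.
split; last by split=> [a c c0|alpha alpha0];
  [exact: star_condition_large|exact: star_condition_small_angle].
move=> a c alpha c0 _ alpha0 star.
apply: le_lt_trans (robin_eigenvalue_equilateral_gt S_gt0 alpha0).
apply: le_trans (robin_eigenvalue_le a S_gt0 c0 (sharpest_vertex (triangle S a c)) alpha0) _.
rewrite lee_fin; apply: le_trans star; rewrite mulNr lerN2.
rewrite -/(smallest_angle _) ler_piMr ?divr_ge0 ?sqr_ge0// lerBlDr lerDl mulr_ge0// expR_ge0.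
Qed.
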